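(* Let $c=\inf\{I(A): A\in\mathcal{D},\ \lambda_A=1\}$. Then the following hold. (a) If $0<\alpha\le1$, then $c=\min(b,a)$ if $1\in\mathrm{supp}(\nu_1)$, and $c=a$ otherwise. (b) If $1<\alpha<2$, $1\in\mathrm{supp}(\nu_1)$ and $b\le\frac a2$, then $c=b$. (c) If $1<\alpha<2$, $1\in\mathrm{supp}(\nu_1)\cap\mathrm{supp}(\nu_2)$ and $b>\frac a2$, then $$c=\min\Big\{I\Big(B^{(n)}\Big(\big(\tfrac1b\big)^{\frac1{\alpha-1}},\big(\tfrac2a\big)^{\frac1{\alpha-1}}\Big)\Big): n\in\mathbb{N},\ n\ge1\Big\}.$$ Equivalently, $c=\min\left(\psi(\lfloor t_0\rfloor),\psi(\lceil t_0\rceil)\right)$ (where a term whose argument lies outside the domain $[1,\infty)$ of $\psi$ is disregarded), with $$\psi(t)=\frac{t}{\left(\left(\frac1b\right)^{\frac1{\alpha-1}}+(t-1)\left(\frac2a\right)^{\frac1{\alpha-1}}\right)^{\alpha-1}}\quad(t\ge1),\qquad t_0=\frac1{2-\alpha}\Big(1-\Big(\frac a{2b}\Big)^{\frac1{\alpha-1}}\Big).$$ (d) If $1<\alpha<2$, $1\in\mathrm{supp}(\nu_1)$, $\mathrm{supp}(\nu_2)=\{-1\}$ and $b>\frac a2$, then $$c=\min\Big(b,\ \frac{2}{\left(\left(\frac1b\right)^{\frac1{\alpha-1}}+\left(\frac2a\right)^{\frac1{\alpha-1}}\right)^{\alpha-1}}\Big).$$ (e) If $1<\alpha<2$, $\mathrm{supp}(\nu_1)=\{-1\}$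 and $1\in\mathrm{supp}(\nu_2)$, then $$c=\min\{I(B^{(n)}(0,1)): n\ge2\}=\min\left(\phi(\lfloor t_1\rfloor),\phi(\lceil t_1\rceil)\right)$$ (where a term whose argument lies outside the domain $[2,\infty)$ of $\phi$ is disregarded), with $$\phi(t)=\frac a2\,\frac{t}{(t-1)^{\alpha-1}}\quad(t\ge2),\qquad t_1=\frac1{2-\alpha}.$$ (f) If $1<\alpha<2$ and $\mathrm{supp}(\nu_1)=\mathrm{supp}(\nu_2)=\{-1\}$, then $c=a$.
   Context: Standing assumptions. Let $\alpha\in(0,2)$ and $a,b\in(0,+\infty)$. Let $(X_{i,j})_{i<j}$ be i.i.d. complex-valued random variables with $\mathbb{E}(X_{1,2})=0$ and $\mathbb{E}|X_{1,2}|^2=1$, and let $(X_{i,i})_{i\ge1}$ be i.i.d. real-valued random variables, the two families being independent. In the case where $X_{1,2}$ is complex, $\Re(X_{1,2})$ and $\Im(X_{1,2})$ are independent. Assume $$\lim_{t\to+\infty}-t^{-\alpha}\log\mathbb{P}(|X_{1,1}|>t)=b,\qquad \lim_{t\to+\infty}-t^{-\alpha}\log\mathbb{P}(|X_{1,2}|>t)=a,$$ and that there are two probability measures $\nu_1,\nu_2$ on the unit circle $\mathbb{S}^1\subset\mathbb{C}$ and $t_0'>0$ such that for all $t\ge t_0'$ and all measurable $U\subset\mathbb{S}^1$, $\mathbb{P}(X_{1,1}/|X_{1,1}|\in U,|X_{1,1}|\ge t)=\nu_1(U)\mathbb{P}(|X_{1,1}|\ge t)$ and $\mathbb{P}(X_{1,2}/|X_{1,2}|\in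 U,|X_{1,2}|\ge t)=\nu_2(U)\mathbb{P}(|X_{1,2}|\ge t)$. (In particular $\nu_1$ is supported in $\{-1,1\}$, since $X_{1,1}$ is real.) $H_n(\mathbb{C})$ is the set of $n\times n$ Hermitian matrices, $\lambda_A$ is the largest eigenvalue of $A$, and $\mathrm{supp}$ denotes the support of a measure. For $A\in\cup_{n\ge1}H_n(\mathbb{C})$, $$I(A)=b\sum_{i}|A_{i,i}|^\alpha+a\sum_{i<j}|A_{i,j}|^\alpha,$$ $$\mathcal{D}=\Big\{A\in\cup_{n\ge1}H_n(\mathbb{C}):\forall i\le j,\ A_{i,j}=0\text{ or }\frac{A_{i,j}}{|A_{i,j}|}\in\mathrm{supp}(\nu_{i,j})\Big\},$$ with $\nu_{i,j}=\nu_1$ if $i=j$ and $\nu_{i,j}=\nu_2$ if $i<j$. For $n\ge1$ and reals $s,t\ge0$ with $s+(n-1)t\ne0$, $B^{(n)}(s,t)$ is the $n\times n$ matrix equal to $\frac{1}{s+(n-1)t}$ times the matrix with all diagonal entries equal to $s$ and all off-diagonal entries equal to $t$. $\lfloor\cdot\rfloor$ and $\lceil\cdot\rceil$ are the lower and upper integer parts. *)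

(* Defs.v *)
From HB Require Import structures.
From mathcomp Require Import all_boot all_order all_algebra.
From mathcomp Require Import finmap.
From mathcomp Require Import all_classical all_reals all_analysis.
From mathcomp Require Import complex.

Set Implicit Arguments.
Unset Strict Implicit.
Unset Printing Implicit Defensive.

Import Order.TTheory GRing.Theory Num.Theory.
Import numFieldNormedType.Exports.

Local Open Scope classical_set_scope.
Local Open Scope ring_scope.
Local Open Scope complex_scope.

(* The usual topology of the complex numbers: the one induced by the modulus,
   which is what the numFieldType R[i] provides on R[i]^o. *)
HB.instance Definition _ (R : realType) :=
  PseudoMetricNormedZmod.copy R[i] (R[i])^o.

Definition borelC (R : realType) : measurableType ((@open R[i]).-sigma) :=
  g_sigma_algebraType (@open R[i]).

(* The norm of R[i] takes its values in R[i]; this is the same number in R. *)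
Definition modulus (R : realType) (z : R[i]) : R := complex.Re `|z|.

Definition unit_circle (R : realType) : set R[i] := [set z | modulus z = 1].

Definition msupport (R : realType) (nu : probability (borelC R) R) : set R[i] :=
  [set z | forall U : set R[i], open U -> U z -> (0 < nu U)%E].

Section independence.
Context d (T : measurableType d) (R : realType) (P : probability T R).

Definition independent_family (I : choiceType) (D : set I)
    d' (T' : measurableType d') (X : I -> {RV P >-> T'}) : Prop :=
  forall (F : {fset I}) (U : I -> set T'),
    [set` F] `<=` D -> (forall i, measurable (U i)) ->
    P (\bigcap_(i in [set` F]) X i @^-1` U i) =
    (\prod_(i <- F) P (X i @^-1` U i))%E.

Definition identically_distributed (I : choiceType) (D : set I)
    d' (T' : measurableType d') (X : I -> {RV P >-> T'}) : Prop :=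
  forall i j, D i -> D j -> forall U, measurable U ->
    distribution P (X i) U = distribution P (X j) U.

Definition iid (I : choiceType) (D : set I)
    d' (T' : measurableType d') (X : I -> {RV P >-> T'}) : Prop :=
  independent_family D X /\ identically_distributed D X.

Definition generated_sigma_algebra (I : choiceType) (D : set I)
    d' (T' : measurableType d') (X : I -> {RV P >-> T'}) : set (set T) :=
  <<s \bigcup_(i in D) preimage_set_system setT (X i) measurable >>.

Definition independent_sigma_algebras (F G : set (set T)) : Prop :=
  forall A B, F A -> G B -> P (A `&` B) = (P A * P B)%E.

Definition tail_exponent (alpha r : R) (Y : T -> R[i]) : Prop :=
  ((- (t `^ (- alpha)))%:E * lne (P [set w | (t < modulus (Y w))%R]))%E
    @[t --> +oo%R] --> r%:E.

Definition directions_from (t0 : R) (nu : probability (borelC R) R)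
    (Y : T -> R[i]) : Prop :=
  forall t (U : set (borelC R)),
    t0 <= t -> measurable U -> U `<=` @unit_circle R ->
    P [set w | U (Y w / `|Y w|) /\ t <= modulus (Y w)] =
    (nu U * P [set w | (t <= modulus (Y w))%R])%E.

End independence.

Definition above_diagonal : set (nat * nat) := [set ij | (ij.1 < ij.2)%N].

(* Indices start at 0, so X_{1,1} is Xd 0 and X_{1,2} is Xo (0, 1); only the
   variables Xo (i, j) with i < j matter. A probability measure on the unit
   circle is a Borel probability measure on the complex plane carried by the
   circle. If X_{1,2} is real, the independence of its real and imaginary
   parts holds automatically, so no case distinction is needed. *)
Record wigner_assumptions d (T : measurableType d) (R : realType)
    (P : probability T R) (alpha a b : R)
    (Xd : nat -> {RV P >-> R}) (Xo : nat * nat -> {RV P >-> borelC R})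
    (nu1 nu2 : probability (borelC R) R) : Prop := WignerAssumptions {
  offdiag_iid : iid above_diagonal Xo ;
  diag_iid : iid setT Xd ;
  diag_offdiag_independent :
    independent_sigma_algebras P
      (generated_sigma_algebra setT Xd)
      (generated_sigma_algebra above_diagonal Xo) ;
  offdiag_mean_Re : ('E_P[fun w => complex.Re (Xo (0, 1)%N w)] = 0)%E ;
  offdiag_mean_Im : ('E_P[fun w => complex.Im (Xo (0, 1)%N w)] = 0)%E ;
  offdiag_variance : ('E_P[fun w => (modulus (Xo (0, 1)%N w) ^+ 2)%R] = 1)%E ;
  offdiag_Re_Im_independent : forall U V : set R, measurable U -> measurable V ->
    P ([set w | U (complex.Re (Xo (0, 1)%N w))] `&`
       [set w | V (complex.Im (Xo (0, 1)%N w))]) =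
    (P [set w | U (complex.Re (Xo (0, 1)%N w))] *
     P [set w | V (complex.Im (Xo (0, 1)%N w))])%E ;
  diag_tail : tail_exponent P alpha b (fun w => (Xd 0%N w)%:C) ;
  offdiag_tail : tail_exponent P alpha a (Xo (0, 1)%N) ;
  nu1_circle : nu1 (@unit_circle R) = 1%E ;
  nu2_circle : nu2 (@unit_circle R) = 1%E ;
  directions : exists2 t0 : R, 0 < t0 &
    directions_from P t0 nu1 (fun w => (Xd 0%N w)%:C) /\
    directions_from P t0 nu2 (Xo (0, 1)%N)
}.

Section variational_problem.
Context (R : realType).

Definition energy (alpha a b : R) n (A : 'M[R[i]]_n) : R :=
  b * (\sum_(i < n) modulus (A i i) `^ alpha) +
  a * (\sum_(i < n) \sum_(j < n | (i < j)%N) modulus (A i j) `^ alpha).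

Definition admissible (nu1 nu2 : probability (borelC R) R) n
    (A : 'M[R[i]]_n) : Prop :=
  A \is hermsymmx /\
  forall i j : 'I_n, (i <= j)%N ->
    A i j = 0 \/
    msupport (if i == j then nu1 else nu2) (A i j / `|A i j|).

Definition largest_eigenvalue n (A : 'M[R[i]]_n) (l : R) : Prop :=
  eigenvalue A l%:C /\ forall m : R, eigenvalue A m%:C -> m <= l.

Definition energy_inf (alpha a b : R) (nu1 nu2 : probability (borelC R) R) : R :=
  inf (\bigcup_(n in [set n | (1 <= n)%N])
    [set energy alpha a b A | A in
      [set A : 'M[R[i]]_n | admissible nu1 nu2 A /\ largest_eigenvalue A 1]]).

Definition Bmx n (s t : R) : 'M[R[i]]_n :=
  \matrix_(i, j) ((if i == j then s else t) / (s + (n%:R - 1) * t))%:C.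

Definition is_min (S : set R) (m : R) : Prop := S m /\ lbound S m.

Definition psi (alpha a b t : R) : R :=
  t / ((1 / b) `^ (1 / (alpha - 1)) +
       (t - 1) * (2 / a) `^ (1 / (alpha - 1))) `^ (alpha - 1).

Definition psi_argmin (alpha a b : R) : R :=
  1 / (2 - alpha) * (1 - (a / (2 * b)) `^ (1 / (alpha - 1))).

Definition phi (alpha a t : R) : R := a / 2 * (t / (t - 1) `^ (alpha - 1)).

Definition phi_argmin (alpha : R) : R := 1 / (2 - alpha).

(* The values of f at the lower and upper integer parts of u, omitting an
   argument that lies outside the domain [lo, +oo[ of f. *)
Definition rounded_values (f : R -> R) (lo u : R) : set R :=
  [set f x | x in [set (Num.floor u)%:~R; (Num.ceil u)%:~R] `&`
                  [set x | lo <= x]].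

End variational_problem.

(* Main.v *)
(** Pairing A v = v with a unit eigenvector v gives
    1 <= sum_i A_ii |v_i|^2 + 2 sum_(i < j) |A_ij| |v_i| |v_j|. For alpha <= 1
    every entry of modulus at most 1 is dominated by its alpha-th power. For
    alpha > 1, Young's inequality with the weights b and a reduces the lower
    bound on I(A) to maximising, over the probability vectors u = (|v_i|^2),
      S sum_i w_i^2 + T sum_(i <> j) w_i w_j,   w_i = u_i^q,
    where S = (1/b)^(1/(alpha-1)) (S = 0 if 1 is not in supp nu_1),
    T = (2/a)^(1/(alpha-1)) and q = (1 + 1/(alpha-1))/2 > 1. Along a segment on
    which u_i + u_j is constant, w_i + w_j is bounded by its chord as a function
    of w_i w_j, hence so is the whole form: an unequal pair can be replaced by
    (u_i + u_j, 0) or by its mean. So a maximiser of minimal support is uniform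
    on k coordinates, where the form is psi(k)^(-1/(alpha-1)); Bernoulli's
    inequality locates the best integer k next to t_0. When supp nu_2 = {-1} the
    matrix has real off-diagonal entries, only pairs of opposite signs count,
    and grouping the coordinates by sign leaves a two-coordinate problem. *)

Require Import Defs.
From mathcomp Require Import all_boot all_order all_algebra.
From mathcomp Require Import all_classical all_reals all_analysis.
From mathcomp Require Import complex.
From mathcomp Require Import ring lra.

Set Implicit Arguments.
Unset Strict Implicit.
Unset Printing Implicit Defensive.

Import Order.TTheory GRing.Theory Num.Theory.
Import numFieldNormedType.Exports.

Local Open Scope classical_set_scope.
Local Open Scope ring_scope.
Local Open Scope complex_scope.

(** * Inequalities for real powers *)

Section real_powers.
Context {R : realType}.
Implicit Types (p q r s x y : R).

(** Young's inequality with the conjugate exponents 1/p and 1/(1-p), applied to (1+y)^p and 1. *)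
Lemma powR_bernoulli_le p y : 0 < p < 1 -> - 1 <= y ->
  (1 + y) `^ p <= 1 + p * y.
Proof.
move=> /andP[p0 p1] y1.
have q0 : 0 < 1 - p by rewrite subr_gt0.
have := @conjugate_powR R ((1 + y) `^ p) 1 p^-1 (1 - p)^-1 (powR_ge0 _ _) ler01.
rewrite !invr_gt0 !invrK => /(_ p0 q0 (subrKC _ _)).
rewrite mulr1 -powRrM divff ?gt_eqF// powRr1 ?powR1; last by lra.
by move=> /le_trans; apply; lra.
Qed.

(** Because x + y = 1, the point x is the convex combination of y and 1 with weights y/x and 1 -
    y/x. Convexity of t^(r-1) along it, multiplied by x, gives the claim. *)
Lemma powR_sub_le r x y : 2 <= r -> 0 <= y <= x -> x + y = 1 ->
  x `^ r - y `^ r <= x - y.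
Proof.
move=> r2 /andP[y0 yx] xy1.
have x0 : 0 < x by lra.
have mu0 : 0 <= y / x by rewrite divr_ge0// ltW.
have mu1 : y / x <= 1 by rewrite ler_pdivrMr// mul1r.
have r1 : 1 <= r - 1 by lra.
have := convex_powR r1 (Itv01 mu0 mu1) (x := y) (y := 1).
rewrite !inE/= !in_itv/= y0 ler01 => /(_ isT isT).
rewrite [X in X `^ _ <= _ -> _]convRE convRE/= /unstable.onem powR1.
have -> : y / x * y + (1 - y / x) * 1 = x.
  have -> : y = 1 - x by lra.
  by field; rewrite gt_eqF.
move=> h; rewrite -(@mulr_powRB1 _ x) ?(ltW x0)//; last by lra.
rewrite -(@mulr_powRB1 _ y)//; last by lra.
have : x * x `^ (r - 1) <= x * (y / x * y `^ (r - 1) + (1 - y / x) * 1).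
  by rewrite ler_pM2l.
have -> : x * (y / x * y `^ (r - 1) + (1 - y / x) * 1) =
   y * y `^ (r - 1) + x - y by field; rewrite gt_eqF.
by move=> ?; lra.
Qed.

(** This is the chord inequality [powR_chord_unit] divided by (1-x^2)^q. In this form the difference
    of the two sides is nondecreasing in x, and it vanishes at x = 0. *)
Lemma powRN_convex_bound q x : 1 < q -> 0 <= x < 1 ->
  (1 - x) `^ (- q) + (1 + x) `^ (- q) <=
  2 `^ q * ((1 - x ^+ 2) `^ (- q) - 1) + 2.
Proof.
move=> q1 /andP[x0 x1].
(* Right side minus left side, up to an additive constant, so that the claim reads N 0 <= N x. *)
pose N := fun x : R => 2 `^ q * (1 - x ^+ 2) `^ (- q)
            - (1 - x) `^ (- q) - (1 + x) `^ (- q).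
have dN (z : R) : -1 < z < 1 -> is_derive z 1 N
   (q * (2 `^ (q + 1) * z * (1 - z ^+ 2) `^ (- q - 1)
         - (1 - z) `^ (- q - 1) + (1 + z) `^ (- q - 1))).
  move=> /andP[z1 z2].
  have h1 : 0 < 1 - z by lra.
  have h2 : 0 < 1 + z by lra.
  have h3 : 0 < 1 - z ^+ 2 by nra.
  have d1 : is_derive z 1 (fun z : R => (1 - z ^+ 2) `^ (- q))
      ((- q * (1 - z ^+ 2) `^ (- q - 1)) * (- (2 * z))).
    apply: (@is_derive1_comp _ (fun y : R => y `^ (- q)) (fun z : R => 1 - z ^+ 2)).
      exact: is_derive1_powR.
    by apply: is_derive_eq; rewrite /GRing.scale/=; ring.
  have d2 : is_derive z 1 (fun z : R => (1 - z) `^ (- q))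
      ((- q * (1 - z) `^ (- q - 1)) * (- 1)).
    apply: (@is_derive1_comp _ (fun y : R => y `^ (- q)) (fun z : R => 1 - z)).
      exact: is_derive1_powR.
    by apply: is_derive_eq; rewrite /GRing.scale/=; ring.
  have d3 : is_derive z 1 (fun z : R => (1 + z) `^ (- q))
      ((- q * (1 + z) `^ (- q - 1)) * 1).
    apply: (@is_derive1_comp _ (fun y : R => y `^ (- q)) (fun z : R => 1 + z)).
      exact: is_derive1_powR.
    by apply: is_derive_eq; rewrite /GRing.scale/=; ring.
  apply: is_derive_eq.
  rewrite powRD; last by apply/implyP => _; rewrite pnatr_eq0.
  by rewrite powRr1// /GRing.scale/=; ring.
have N0x : N 0 <= N x.
  have dv (z : R) : z \in `](-1), 1[%R -> derivable N z 1.
    by rewrite in_itv/= => /dN [].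
  have h (z : R) : z \in `]0, x[%R -> derivable N z 1.
    by rewrite in_itv/= => /andP[z0 z1]; apply: dv; rewrite in_itv/=; lra.
  apply: (@ger0_derive1_ndecr _ N 0 x h) => //.
    move=> z; rewrite in_itv/= => /andP[z0 zx].
    have z1 : -1 < z < 1 by lra.
    rewrite derive1E; have [_ ->] := dN z z1.
    apply: mulr_ge0; first lra.
    have h1 : 0 < 1 - z by lra.
    have h2 : 0 < 1 + z by lra.
    have E1 : - q - 1 = - (q + 1) by ring.
    have E2 : 1 - z ^+ 2 = (1 - z) * (1 + z) by ring.
    rewrite E1 !powRN E2 powRM ?(ltW h1) ?(ltW h2)//.
    (* Once denominators are cleared, the derivative is nonnegative exactly when (1+z)^(q+1) -
       (1-z)^(q+1) <= 2^(q+1) z, which is [powR_sub_le] at the two halves (1+z)/2 and (1-z)/2. *)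
    have /(_ (q + 1) ((1 + z) / 2) ((1 - z) / 2)) := powR_sub_le.
    have g1 : 2 <= q + 1 by lra.
    have g2 : 0 <= (1 - z) / 2 <= (1 + z) / 2 by lra.
    have g3 : (1 + z) / 2 + (1 - z) / 2 = 1 by lra.
    move=> /(_ g1 g2 g3).
    rewrite !powRM ?(ltW h1) ?(ltW h2) ?invr_ge0//.
    have -> : 2^-1 `^ (q + 1) = (2 `^ (q + 1))^-1 :> R.
      by rewrite -(powR_inv1 (ler0n R 2)) -powRrM mulrC powRrM powR_inv1 ?powR_ge0.
    have : 0 < (1 - z) `^ (q + 1) by exact: powR_gt0.
    have : 0 < (1 + z) `^ (q + 1) by exact: powR_gt0.
    have : 0 < 2 `^ (q + 1) :> R by exact: powR_gt0.
    move: ((1 - z) `^ _) ((1 + z) `^ _) (2 `^ _) => A B C C0 B0 A0 H.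
    have -> : C * z * (A * B)^-1 - A^-1 + B^-1 = (C * z + A - B) / (A * B).
      by field; rewrite !gt_eqF.
    apply: divr_ge0; last by rewrite mulr_ge0// ltW.
    have : (B / C - A / C) * C <= (((1 + z) / 2) - (1 - z) / 2) * C.
      by rewrite ler_wpM2r// ltW.
    have -> : (B / C - A / C) * C = B - A by field; rewrite gt_eqF.
    by lra.
  apply: derivable_within_continuous => z; rewrite in_itv/= => /andP[z0 zx].
  by apply: dv; rewrite in_itv/=; lra.
move: N0x; rewrite /N expr0n/= !subr0 addr0 !powR1 => ?; lra.
Qed.

Lemma powR_chord_unit q x : 1 < q -> 0 <= x < 1 ->
  (1 + x) `^ q + (1 - x) `^ q <=
  (1 - (1 - x ^+ 2) `^ q) * 2 `^ q + (1 - x ^+ 2) `^ q * 2.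
Proof.
move=> q1 x01; have /andP[x0 x1] := x01.
have h1 : 0 < 1 - x by lra.
have h2 : 0 < 1 + x by lra.
have E2 : 1 - x ^+ 2 = (1 - x) * (1 + x) by ring.
have := powRN_convex_bound q1 x01.
rewrite !powRN E2 powRM ?(ltW h1) ?(ltW h2)//.
have : 0 < (1 - x) `^ q by exact: powR_gt0.
have : 0 < (1 + x) `^ q by exact: powR_gt0.
move: (_ `^ q) ((1 - x) `^ _) (2 `^ _) => B A C B0 A0 H.
have : (A^-1 + B^-1) * (A * B) <= (C * ((A * B)^-1 - 1) + 2) * (A * B).
  by rewrite ler_wpM2r// mulr_ge0// ltW.
have -> : (A^-1 + B^-1) * (A * B) = A + B by field; rewrite !gt_eqF.
have -> : (C * ((A * B)^-1 - 1) + 2) * (A * B) = C * (1 - A * B) + 2 * (A * B).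
  by field; rewrite !gt_eqF.
by move=> ?; lra.
Qed.

(* Along x + y = m the sum x^q + y^q is a convex function of the product
   (x y)^q; only the chord from y = 0 to x = y is needed. *)
Lemma powR_chord q x y : 1 < q -> 0 < x -> 0 < y ->
  let l := (4 * x * y / (x + y) ^+ 2) `^ q in
  x `^ q + y `^ q <= (1 - l) * (x + y) `^ q + l * (2 * ((x + y) / 2) `^ q).
Proof.
move=> q1; wlog yx : x y / y <= x.
  move=> H x0 y0; have [|/ltW] := leP y x => h; first exact: H.
  move: (H y x h y0 x0) => /=.
  by rewrite (addrC y x) (addrC (y `^ q)) -(mulrA 4) (mulrC y) (mulrA 4).
move=> x0 y0 /=; set l := (4 * x * y / (x + y) ^+ 2) `^ q.
set m := x + y; have m0 : 0 < m by rewrite addr_gt0.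
(* Rescaling by m/2 turns x and y into 1 + z and 1 - z, and l into (1 - z^2)^q. *)
pose z := (x - y) / m.
have z01 : 0 <= z < 1.
  by rewrite divr_ge0/= ?subr_ge0 ?(ltW m0)// ltr_pdivrMr// /m; lra.
have /= := powR_chord_unit q1 z01.
have -> : 1 - z ^+ 2 = 4 * x * y / m ^+ 2 by rewrite /z /m; field; rewrite gt_eqF.
rewrite -/l -(ler_pM2r (powR_gt0 q (divr_gt0 m0 (ltr0Sn R 1)))) => H.
have xE : x = (1 + z) * (m / 2) by rewrite /z /m; field; rewrite gt_eqF.
have yE : y = (1 - z) * (m / 2) by rewrite /z /m; field; rewrite gt_eqF.
have mE : m = 2 * (m / 2) by field.
have m2 : 0 <= m / 2 by rewrite divr_ge0// ltW.
move: z01 => /andP[z0 z1].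
rewrite [in x `^ q]xE [in y `^ q]yE [in m `^ q]mE.
move: (m / 2) H m2 => M H M0.
rewrite !powRM//; lra.
Qed.

End real_powers.

(** * The quadratic form on the simplex *)

Section simplex.
Context {R : realType}.
Implicit Types (q S T M W Q x y : R).

Lemma continuous_powR_norm q : 0 < q -> continuous (fun x : R => `|x| `^ q).
Proof.
move=> q0 x; have [->|x0] := eqVneq x 0; last first.
  apply: (@continuous_comp _ _ _ (Num.norm : R -> R) (fun y : R => y `^ q)).
    exact: norm_continuous.
  apply/differentiable_continuous/derivable1_diffP/derivable_powR.
  by rewrite in_itv/= andbT normr_gt0.
rewrite /continuous_at normr0 powR0 ?gt_eqF//.
apply/cvgrPdist_lt => e e0; near=> t.
rewrite sub0r normrN ger0_norm ?powR_ge0//.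
have -> : e = (e `^ q^-1) `^ q.
  by rewrite -powRrM mulVf ?gt_eqF// powRr1// ltW.
apply: gt0_ltr_powR; rewrite ?nnegrE ?powR_ge0//.
near: t.
have := @nbhsx_ballx _ _ (0 : R) (e `^ q^-1) (powR_gt0 _ e0).
by apply: filterS => t; rewrite /ball/= sub0r normrN.
Unshelve. all: by end_near. Qed.

(** With l = (4xy/(x+y)^2)^q, the product (xy)^q is exactly the l-weighted mean of its values 0 at
    (x+y, 0) and ((x+y)/2)^(2q) at the midpoint, while x^q + y^q lies below the corresponding mean
    by [powR_chord]. The products therefore cancel in the difference of the two sides, leaving
    nonnegative terms. The strict bound l < 1, from x != y, is what lets a maximiser move to (x+y,
    0). *)
Lemma pair_energy_le q S T W Q x y : 1 < q -> 0 <= S -> 0 <= T -> 0 <= W ->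
  0 < x -> 0 < y -> x != y ->
  exists2 l : R, 0 <= l < 1 &
  T * (x `^ q + y `^ q + W) ^+ 2 + (S - T) * ((x `^ q) ^+ 2 + (y `^ q) ^+ 2 + Q)
  <= (1 - l) * (T * ((x + y) `^ q + 0 `^ q + W) ^+ 2
                + (S - T) * (((x + y) `^ q) ^+ 2 + (0 `^ q) ^+ 2 + Q))
   + l * (T * (((x + y) / 2) `^ q + ((x + y) / 2) `^ q + W) ^+ 2
      + (S - T) * ((((x + y) / 2) `^ q) ^+ 2 + (((x + y) / 2) `^ q) ^+ 2 + Q)).
Proof.
move=> q1 S0 T0 W0 x0 y0 xy.
have m0 : 0 < x + y by rewrite addr_gt0.
have q0 : q != 0 by rewrite gt_eqF// (lt_trans ltr01).
have l0 : 0 <= 4 * x * y / (x + y) ^+ 2.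
  by rewrite divr_ge0 ?exprn_ge0 ?mulr_ge0// ltW.
have l1 : 4 * x * y / (x + y) ^+ 2 < 1.
  rewrite ltr_pdivrMr ?exprn_gt0// mul1r -subr_gt0.
  have -> : (x + y) ^+ 2 - 4 * x * y = (x - y) ^+ 2 by ring.
  by rewrite exprn_even_gt0//= subr_eq0.
have one : 1 = 1 `^ q :> R by rewrite powR1.
exists ((4 * x * y / (x + y) ^+ 2) `^ q).
  rewrite powR_ge0/= [X in _ < X]one gt0_ltr_powR ?nnegrE//.
  exact: lt_trans q1.
have PE : x `^ q * y `^ q =
    (4 * x * y / (x + y) ^+ 2) `^ q * (((x + y) / 2) `^ q) ^+ 2.
  have m2 : 0 <= (x + y) / 2 by rewrite divr_ge0// ltW.
  rewrite (expr2 (_ `^ q)) -(powRM q m2 m2) -(powRM q l0 (mulr_ge0 m2 m2)).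
  rewrite -(powRM q (ltW x0) (ltW y0)); congr (_ `^ _).
  by field; rewrite gt_eqF.
have := powR_chord q1 x0 y0.
have := powR_ge0 (4 * x * y / (x + y) ^+ 2) q.
have : (4 * x * y / (x + y) ^+ 2) `^ q <= 1.
  rewrite [X in _ <= X]one ge0_ler_powR ?nnegrE// ?ltW//.
  exact: lt_trans q1.
have := powR_ge0 x q; have := powR_ge0 y q.
rewrite (powR0 q0) /=.
move: (x `^ q) (y `^ q) PE => X Y.
move: ((4 * x * y / (x + y) ^+ 2) `^ q) => l.
move: (((x + y) / 2) `^ q) ((x + y) `^ q) => h G PE Y0 X0 l1' l0' fle.
set g := (1 - l) * G + l * (2 * h) in fle.
have g2 : (X + Y) ^+ 2 <= g ^+ 2.
  have XY0 : 0 <= X + Y by rewrite addr_ge0.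
  by rewrite lerXn2r ?nnegrE//; exact: le_trans fle.
rewrite -subr_ge0.
have -> : (1 - l) * (T * (G + 0 + W) ^+ 2 + (S - T) * (G ^+ 2 + 0 ^+ 2 + Q)) +
    l * (T * (h + h + W) ^+ 2 + (S - T) * (h ^+ 2 + h ^+ 2 + Q)) -
    (T * (X + Y + W) ^+ 2 + (S - T) * (X ^+ 2 + Y ^+ 2 + Q)) =
  S * (l * (1 - l) * (G - 2 * h) ^+ 2) + S * (g ^+ 2 - (X + Y) ^+ 2)
  + 2 * T * W * (g - (X + Y)) + 2 * (S - T) * (X * Y - l * h ^+ 2).
  by rewrite /g; ring.
rewrite PE subrr mulr0 addr0.
apply: addr_ge0; [apply: addr_ge0|]; apply: mulr_ge0 => //.
- by apply: mulr_ge0; rewrite ?sqr_ge0// mulr_ge0// subr_ge0.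
- by rewrite subr_ge0.
- by rewrite !mulr_ge0.
- by rewrite subr_ge0.
Qed.

Lemma sum_update n (g : R -> R) (u : 'I_n -> R) i j x y : i != j ->
  \sum_k g (if k == i then x else if k == j then y else u k) =
  g x + g y + \sum_(k | (k != i) && (k != j)) g (u k).
Proof.
move=> ij; rewrite (bigD1 i)//= (bigD1 j)/=; last by rewrite eq_sym.
rewrite !eqxx eq_sym (negbTE ij) addrA; congr (_ + _).
by apply: eq_bigr => k /andP[/negbTE -> /negbTE ->].
Qed.

Lemma sum_split2 n (g : R -> R) (u : 'I_n -> R) i j : i != j ->
  \sum_k g (u k) = g (u i) + g (u j) + \sum_(k | (k != i) && (k != j)) g (u k).
Proof.
by move=> ij; rewrite (bigD1 i)//= (bigD1 j)/= ?addrA// eq_sym.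
Qed.

Definition simplex n : set 'rV[R]_n :=
  [set w | (forall i, 0 <= w 0 i) /\ \sum_i w 0 i = 1].

Lemma compact_simplex n : compact (@simplex n).
Proof.
apply: (@subclosed_compact _ _ [set w : 'rV[R]_n | forall i, `[0, 1]%classic (w 0 i)]).
- apply: closedI.
    rewrite [X in closed X](_ : _ = \bigcap_(i in [set: 'I_n])
        ((fun w : 'rV[R]_n => w 0 i) @^-1` [set x | 0 <= x])); last first.
      by apply/seteqP; split=> w /= h i; [move=> _|]; exact: h.
    apply: closed_bigI => i _.
    by apply: preimage_closed; [move=> ? _; exact: coord_continuous|exact: closed_ge].
  apply: (@preimage_closed _ _ (fun w : 'rV[R]_n => \sum_i w 0 i) [set x | x = 1]).
    move=> w _.
    apply: continuous_big; first exact: add_continuous.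
    by move=> i _; exact: coord_continuous.
  exact: closed_eq.
- apply: (@rV_compact R n (fun=> `[0, 1]%classic)) => _.
  exact: segment_compact.
- move=> w [w0 w1] i /=; rewrite in_itv/= w0 -w1 (bigD1 i)//= lerDl.
  by rewrite sumr_ge0.
Qed.

(** With w_i = |u_i|^q this is S sum_i w_i^2 + T sum_(i <> j) w_i w_j. The absolute values make it
    continuous on the whole space and change nothing on the simplex. *)
Definition pair_form n q S T (u : 'I_n -> R) :=
  T * (\sum_i `|u i| `^ q) ^+ 2 + (S - T) * \sum_i (`|u i| `^ q) ^+ 2.

Lemma continuous_pair_form n q S T : 0 < q ->
  continuous (fun w : 'rV[R]_n => pair_form q S T (fun i => w 0 i)).
Proof.
move=> q0.
have cv i : continuous (fun w : 'rV[R]_n => `|w 0 i| `^ q).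
  move=> w; apply: (@continuous_comp _ _ _ (fun w : 'rV[R]_n => w 0 i)
     (fun x : R => `|x| `^ q)); first exact: coord_continuous.
  exact: continuous_powR_norm.
have cs : continuous (fun w : 'rV[R]_n => \sum_i `|w 0 i| `^ q).
  by apply: continuous_big; [exact: add_continuous|move=> i _; exact: cv].
have cs2 : continuous (fun w : 'rV[R]_n => \sum_i (`|w 0 i| `^ q) ^+ 2).
  apply: continuous_big; first exact: add_continuous.
  move=> i _ w; apply: (@continuous_comp _ _ _ (fun w : 'rV[R]_n => `|w 0 i| `^ q)
    (fun x : R => x ^+ 2)); [exact: cv|exact: exprn_continuous].
have cs1 : continuous (fun w : 'rV[R]_n => (\sum_i `|w 0 i| `^ q) ^+ 2).
  move=> w; apply: (@continuous_comp _ _ _ (fun w : 'rV[R]_n => \sum_i `|w 0 i| `^ q)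
    (fun x : R => x ^+ 2)); [exact: cs|exact: exprn_continuous].
by move=> w; apply: (@continuousD _ _ _
    (fun w : 'rV[R]_n => T * (\sum_i `|w 0 i| `^ q) ^+ 2)
    (fun w : 'rV[R]_n => (S - T) * \sum_i (`|w 0 i| `^ q) ^+ 2));
  apply: (@continuousM _ _ (fun=> _)); [exact: cst_continuous|exact: cs1
    |exact: cst_continuous|exact: cs2].
Qed.

End simplex.

(** * Maximisers of the form on the simplex *)

Section simplex_maximum.
Context {R : realType}.
Implicit Types q S T M : R.

Lemma pair_form_max n q S T : (0 < n)%N -> 0 < q ->
  exists2 w : 'rV[R]_n, @simplex R n w &
    forall t, @simplex R n t ->
      pair_form q S T (fun i => t 0 i) <= pair_form q S T (fun i => w 0 i).
Proof.
move=> n0 q0.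
have A0 : @simplex R n !=set0.
  exists (const_mx (n%:R^-1)); split => [i|]; first by rewrite mxE invr_ge0.
  under eq_bigr do rewrite mxE.
  by rewrite sumr_const card_ord -[LHS]mulr_natr mulVf// pnatr_eq0 -lt0n.
have [] := EVT_max_rV A0 (@compact_simplex R n)
  (continuous_subspaceT (@continuous_pair_form R n q S T q0)).
move=> w /[!inE] w0 H; exists w => // t t0; apply: H; exact/mem_set.
Qed.

(* Replacing two unequal positive coordinates x, y by (x + y, 0) does not
   decrease the form at a maximiser, so a maximiser of minimal support is
   constant on its support. *)
Lemma pair_form_max_flat n q S T : (0 < n)%N -> 1 < q -> 0 <= S -> 0 <= T ->
  exists2 w : 'rV[R]_n, @simplex R n w &
    (forall t, @simplex R n t ->
      pair_form q S T (fun i => t 0 i) <= pair_form q S T (fun i => w 0 i)) /\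
    (forall i j, w 0 i != 0 -> w 0 j != 0 -> w 0 i = w 0 j).
Proof.
move=> n0 q1 S0 T0; have q0 : 0 < q by exact: lt_trans q1.
pose opt (w : 'rV[R]_n) := @simplex R n w /\ forall t, @simplex R n t ->
  pair_form q S T (fun i => t 0 i) <= pair_form q S T (fun i => w 0 i).
pose supp (w : 'rV[R]_n) := [set i | w 0 i != 0]%SET.
have exP : exists k, `[< exists w, opt w /\ #|supp w| = k >].
  have [w ws wm] := pair_form_max S T n0 q0.
  by exists #|supp w|; apply/asboolP; exists w.
case: (ex_minnP exP) => k /asboolP[w [[ws wm] wk]] kmin.
exists w => //; split=> // i j wi wj; apply/eqP; apply: contraT => wij.
have ij : i != j by apply: contra_neq wij => ->.
have [w0 w1] := ws.
pose upd x y : 'rV[R]_n :=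
  \row_k (if k == i then x else if k == j then y else w 0 k).
have wi0 : 0 < w 0 i by rewrite lt0r wi w0.
have wj0 : 0 < w 0 j by rewrite lt0r wj w0.
have upds x y : 0 <= x -> 0 <= y -> x + y = w 0 i + w 0 j -> @simplex R n (upd x y).
  move=> x0 y0 xy; split=> [l|].
    by rewrite mxE; case: ifP => // _; case: ifP.
  under eq_bigr do rewrite mxE.
  rewrite (@sum_update R n id) // xy -w1.
  by rewrite -(@sum_split2 R n id).
pose W := \sum_(l | (l != i) && (l != j)) `|w 0 l| `^ q.
pose Q := \sum_(l | (l != i) && (l != j)) (`|w 0 l| `^ q) ^+ 2.
have updF x y : 0 <= x -> 0 <= y -> pair_form q S T (fun i => upd x y 0 i) =
    T * (x `^ q + y `^ q + W) ^+ 2 + (S - T) * ((x `^ q) ^+ 2 + (y `^ q) ^+ 2 + Q).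
  move=> x0 y0; rewrite /pair_form.
  under eq_bigr do rewrite mxE.
  under [in X in _ + X]eq_bigr do rewrite mxE.
  rewrite (@sum_update R n (fun x => `|x| `^ q))//.
  rewrite (@sum_update R n (fun x => (`|x| `^ q) ^+ 2))//.
  by rewrite !ger0_norm.
have wF : upd (w 0 i) (w 0 j) = w.
  by apply/rowP => l; rewrite mxE; case: eqP => [->//|_]; case: eqP => [->|].
have W0 : 0 <= W by apply: sumr_ge0 => l _; exact: powR_ge0.
have [l /andP[l0 l1]] := pair_energy_le Q q1 S0 T0 W0 wi0 wj0 wij.
set m := w 0 i + w 0 j.
have m0 : 0 <= m by rewrite addr_ge0// ltW.
have m20 : 0 <= m / 2 by rewrite divr_ge0.
rewrite -!updF ?(ltW wi0) ?(ltW wj0)// wF => H.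
have U1 : @simplex R n (upd m 0) by apply: upds; rewrite ?addr0.
have U2 : @simplex R n (upd (m / 2) (m / 2)) by apply: upds => //; rewrite -splitr.
have := wm _ U2.
move: H.
set F0 := pair_form _ _ _ _; set F1 := pair_form _ _ _ _.
set F2 := pair_form _ _ _ _ => H F20.
(* F0 is at most a mean of F1 and F2 and F2 <= F0 by maximality; as F1 has the positive weight 1 -
   l, it cannot be below F0. *)
have F01 : F0 <= F1.
  rewrite -subr_ge0 -(@pmulr_rge0 _ (1 - l)) ?subr_gt0//.
  have : l * F2 <= l * F0 by rewrite ler_wpM2l.
  lra.
have : (k <= #|supp (upd m 0%R)|)%N.
  apply: kmin; apply/asboolP; exists (upd m 0); split=> //; split=> // t ts.
  exact: le_trans (wm _ ts) F01.
rewrite leqNgt -wk; case/negP.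
apply: proper_card; apply/properP; split.
  apply/fintype.subsetP => a; rewrite !inE mxE.
  by case: (a =P i) => [-> //|_]; case: (a =P j) => [_|//]; rewrite eqxx.
by exists j; rewrite !inE// mxE (eq_sym j) (negbTE ij) !eqxx.
Qed.

(** The hypothesis bounds the form at the uniform vector on k coordinates, and some maximiser is of
    that kind by [pair_form_max_flat], with k the size of its support. *)
Lemma simplex_power_bound n q S T M (u : 'I_n -> R) :
  1 < q -> 0 <= S -> 0 <= T ->
  (forall k, (0 < k <= n)%N ->
    k%:R * (S + (k%:R - 1) * T) * (k%:R^-1 `^ q) ^+ 2 <= M) ->
  (forall i, 0 <= u i) -> \sum_i u i = 1 ->
  T * (\sum_i u i `^ q) ^+ 2 + (S - T) * \sum_i (u i `^ q) ^+ 2 <= M.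
Proof.
move=> q1 S0 T0 HM u0 u1.
have n0 : (0 < n)%N.
  by case: n u u0 u1 {HM} => // u _; rewrite big_ord0 => /eqP; rewrite eq_sym oner_eq0.
have q0 : q != 0 by rewrite gt_eqF// (lt_trans _ q1).
have [w [w0 w1] [wm wc]] := pair_form_max_flat n0 q1 S0 T0.
have us : @simplex R n (\row_i u i).
  by split=> [i|]; [rewrite mxE|under eq_bigr do rewrite mxE].
have := wm _ us; rewrite {1}/pair_form.
under eq_bigr do rewrite mxE ger0_norm//.
under [in X in _ + X]eq_bigr do rewrite mxE ger0_norm//.
move=> /le_trans; apply.
pose A := [set i | w 0 i != 0]%SET.
have sumA (g : R -> R) : g 0 = 0 -> \sum_i g (w 0 i) = \sum_(i in A) g (w 0 i).
  move=> g0; rewrite [RHS]big_mkcond; apply: eq_bigr => i _.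
  by rewrite inE; case: eqP => [->|].
have [i iA] : exists i, i \in A.
  apply/set0Pn; apply: contraPneq w1 => A0.
  by rewrite (sumA id)// A0 big_set0 => /eqP; rewrite eq_sym oner_eq0.
have wA j : j \in A -> w 0 j = w 0 i.
  by move: iA; rewrite !inE => ? ?; exact: wc.
have k0 : (0 < #|A|)%N by apply/card_gt0P; exists i.
have kn : (#|A| <= n)%N by rewrite -[n in (_ <= n)%N]card_ord max_card.
have sA (g : R -> R) : g 0 = 0 -> \sum_i g (w 0 i) = #|A|%:R * g (w 0 i).
  move=> g0; rewrite sumA// (eq_bigr (fun=> g (w 0 i))) ?sumr_const ?mulr_natl//.
  by move=> j /wA ->.
have wi : w 0 i = #|A|%:R^-1.
  have := sA id erefl; rewrite w1 => /esym/(canRL (mulKf _)) -> //.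
    by rewrite mulr1.
  by rewrite pnatr_eq0 -lt0n.
have := HM #|A|; rewrite k0 kn => /(_ isT); apply: le_trans.
rewrite /pair_form (sA (fun x => `|x| `^ q)) ?normr0 ?powR0//.
rewrite (sA (fun x => (`|x| `^ q) ^+ 2)) ?normr0 ?powR0 ?expr0n//.
rewrite wi ger0_norm ?invr_ge0//; lra.
Qed.

End simplex_maximum.

(** * From energies to the quadratic form *)

Section energy_bound.
Context {R : realType}.
Implicit Types (alpha a b m p q s t S T : R).

(** For L(t) = S + (t-1)T, the derivative of t / L(t)^p has the sign of L(t) - pTt, so the last
    hypothesis says that the function does not decrease to first order when moving from t towards s.
    Bernoulli's inequality for L(s)/L(t) = 1 + y makes this a comparison of values. *)
Lemma ratio_powR_le p S T s t : 0 < p < 1 -> 0 < t ->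
  0 < S + (s - 1) * T -> 0 < S + (t - 1) * T ->
  (s - t) * (p * T * t - (S + (t - 1) * T)) <= 0 ->
  t / (S + (t - 1) * T) `^ p <= s / (S + (s - 1) * T) `^ p.
Proof.
move=> p01 t0.
set Ls := S + (s - 1) * T; set Lt := S + (t - 1) * T => Ls0 Lt0 st.
pose y := (s - t) * T / Lt.
have LsE : Ls = Lt * (1 + y) by rewrite /y /Ls /Lt; field; rewrite gt_eqF.
have y1 : 0 < 1 + y by rewrite -(pmulr_rgt0 _ Lt0) -LsE.
have y1' : -1 <= y by move: y1; lra.
have st' : 1 + p * y <= s / t.
  rewrite -subr_ge0.
  have -> : s / t - (1 + p * y) = - ((s - t) * (p * T * t - Lt)) / (t * Lt).
    by rewrite /y; field; rewrite !gt_eqF.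
  by rewrite divr_ge0 ?oppr_ge0// mulr_ge0// ltW.
have H := le_trans (powR_bernoulli_le p01 y1') st'.
have yp0 : 0 < (1 + y) `^ p by exact: powR_gt0.
have Lp0 : 0 < Lt `^ p by exact: powR_gt0.
rewrite LsE powRM ?(ltW Lt0) ?(ltW y1)//.
rewrite invfM mulrCA mulrA (mulrC _ s) mulrAC.
rewrite ler_pM2r ?invr_gt0// ler_pdivlMr// mulrC.
by rewrite -ler_pdivlMr.
Qed.

Lemma young_weight alpha a m (x y : R) : 1 < alpha -> 0 < a -> 0 < m ->
  0 <= x -> 0 <= y ->
  x * y <= a * x `^ alpha / (alpha * m)
    + m `^ (1 / (alpha - 1)) * ((1 / a) `^ (1 / (alpha - 1))
      * y `^ (1 + 1 / (alpha - 1))) / (1 + 1 / (alpha - 1)).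
Proof.
move=> al1 a0 m0 x0 y0.
have al0 : 0 < alpha by exact: lt_trans al1.
set g := 1 / (alpha - 1); have g0 : 0 < g by rewrite divr_gt0// subr_gt0.
have be0 : 0 < 1 + g by rewrite addr_gt0.
have cj : alpha^-1 + (1 + g)^-1 = 1.
  by rewrite /g; field; rewrite !gt_eqF// ?subr_gt0//; lra.
(* Chosen so that c^alpha = a/m: Young's inequality for x c and y/c then carries the energy weight
   a, normalised by the target value m. *)
pose c := (a / m) `^ alpha^-1.
have c0 : 0 < c by rewrite powR_gt0// divr_gt0.
have -> : x * y = (x * c) * (y * c^-1) by field; rewrite gt_eqF.
have := @conjugate_powR R (x * c) (y * c^-1) alpha (1 + g)
  (mulr_ge0 x0 (ltW c0)).
rewrite mulr_ge0 ?invr_ge0 ?(ltW c0)// => /(_ isT al0 be0 cj) /le_trans; apply.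
have c0' : 0 <= c^-1 by rewrite invr_ge0 ltW.
rewrite (powRM _ x0 (ltW c0)) (powRM _ y0 c0').
have -> : c `^ alpha = a / m.
  by rewrite -powRrM mulVf ?gt_eqF// powRr1// divr_ge0// ltW.
have -> : c^-1 `^ (1 + g) = m `^ g * (1 / a) `^ g.
  rewrite -(powR_inv1 (ltW c0)) -!powRrM -powRM ?divr_ge0// ?ltW//.
  have -> : alpha^-1 * (-1 * (1 + g)) = - g.
    by rewrite /g; field; rewrite !gt_eqF// ?subr_gt0//; lra.
  rewrite -mulN1r powRrM powR_inv1 ?divr_ge0 ?(ltW a0) ?(ltW m0)//.
  by congr (_ `^ _); field; rewrite !gt_eqF.
rewrite le_eqVlt; apply/orP; left; apply/eqP; congr (_ + _); last by ring.
by field; rewrite !gt_eqF.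
Qed.

(** Young's inequality is summed over all entries. The dual term is at most 1/(1+g) = 1 - 1/alpha,
    so 1 <= E/(alpha m) + 1 - 1/alpha, which is m <= E. *)
Lemma energy_young alpha a b m n (D wd : 'I_n -> R) (r w : 'I_n -> 'I_n -> R) :
  1 < alpha -> 0 < a -> 0 < b -> 0 < m ->
  (forall i, 0 <= D i) -> (forall i, 0 <= wd i) ->
  (forall i j, 0 <= r i j) -> (forall i j, 0 <= w i j) ->
  1 <= \sum_i D i * wd i + 2 * \sum_(i < n) \sum_(j < n | (i < j)%N) r i j * w i j ->
  m `^ (1 / (alpha - 1)) *
   ((1 / b) `^ (1 / (alpha - 1)) * \sum_i wd i `^ (1 + 1 / (alpha - 1)) +
   2 * (2 / a) `^ (1 / (alpha - 1)) *
     \sum_(i < n) \sum_(j < n | (i < j)%N) w i j `^ (1 + 1 / (alpha - 1))) <= 1 ->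
  m <= b * (\sum_i D i `^ alpha) +
       a * (\sum_(i < n) \sum_(j < n | (i < j)%N) r i j `^ alpha).
Proof.
move=> al1 a0 b0 m0 D0 wd0 r0 w0.
have al0 : 0 < alpha by exact: lt_trans al1.
set g := 1 / (alpha - 1); have g0 : 0 < g by rewrite divr_gt0// subr_gt0.
have be0 : 0 < 1 + g by rewrite addr_gt0.
have cj : (1 + g)^-1 = 1 - alpha^-1.
  by rewrite /g; field; rewrite !gt_eqF// ?subr_gt0//; lra.
set X := (X in 1 <= X -> _) => X1.
set F := (F in _ * F <= 1 -> _) => F1.
set E := (E in m <= E).
suff H : X <= E / (alpha * m) + m `^ g * F / (1 + g).
  have : 1 <= E / (alpha * m) + (1 - alpha^-1).
    apply: le_trans (le_trans X1 H) _.
    by rewrite lerD2l -cj ler_pdivrMr// mulVf// gt_eqF.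
  move=> H1.
  have : alpha^-1 <= E / (alpha * m) by move: H1; lra.
  by rewrite ler_pdivlMr ?mulr_gt0// mulrA mulVf ?gt_eqF// mul1r.
(* An off-diagonal entry is counted twice in the form but once in the energy. Putting the 2 on the
   side of y gives 2^(1+g), whence the constant 2 (2/a)^g. *)
have T2 x y : 0 <= x -> 0 <= y -> 2 * (x * y) <= a * x `^ alpha / (alpha * m)
    + m `^ g * (2 * (2 / a) `^ g * y `^ (1 + g)) / (1 + g).
  move=> x0 y0.
  have := @young_weight alpha a m x (2 * y) al1 a0 m0 x0 (mulr_ge0 (ler0n _ 2) y0).
  rewrite mulrCA -/g => /le_trans; apply.
  rewrite le_eqVlt; apply/orP; left; apply/eqP; congr (_ + _ * _ / _).
  rewrite (powRM _ (ler0n R 2) y0) [2 `^ _]powRD ?pnatr_eq0 ?implybT// powRr1//.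
  by rewrite !powRM ?invr_ge0 ?(ltW a0)// powR1; ring.
rewrite /X mulr_sumr.
apply: (@le_trans _ _ (\sum_i (b * D i `^ alpha / (alpha * m)
    + m `^ g * ((1 / b) `^ g * wd i `^ (1 + g)) / (1 + g)) +
   \sum_(i < n) \sum_(j < n | (i < j)%N) (a * r i j `^ alpha / (alpha * m)
    + m `^ g * (2 * (2 / a) `^ g * w i j `^ (1 + g)) / (1 + g)))).
  apply: lerD; first by apply: ler_sum => i _; exact: young_weight.
  apply: ler_sum => i _; rewrite mulr_sumr; apply: ler_sum => j _; exact: T2.
rewrite big_split/=; under [X in _ + _ + X <= _]eq_bigr do rewrite big_split/=.
rewrite [X in _ + _ + X <= _]big_split/=.
rewrite -!mulr_suml -!mulr_sumr.
under [X in _ + _ + (X + _) <= _]eq_bigr do rewrite -mulr_suml -mulr_sumr.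
under [X in _ + _ + (_ + X) <= _]eq_bigr do rewrite -mulr_suml -!mulr_sumr.
rewrite -!mulr_suml -!mulr_sumr.
rewrite le_eqVlt; apply/orP; left; apply/eqP; rewrite /E /F; ring.
Qed.

Lemma sum_ltn_sym n (g : 'I_n -> 'I_n -> R) : (forall i j, g i j = g j i) ->
  2 * \sum_(i < n) \sum_(j < n | (i < j)%N) g i j =
  \sum_i \sum_j g i j - \sum_i g i i.
Proof.
move=> gC.
have E : \sum_i \sum_j g i j = \sum_(i < n) \sum_(j < n | (i < j)%N) g i j +
    \sum_(i < n) \sum_(j < n | (j < i)%N) g i j + \sum_i g i i.
  rewrite -!big_split/=; apply: eq_bigr => i _.
  rewrite (bigD1 i)//= [LHS]addrC; congr (_ + _).
  rewrite (bigID (fun j : 'I_n => (i < j)%N))/=; congr (_ + _); apply: eq_bigl => j.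
    by case: ltngtP => [ij||]; rewrite ?andbT ?andbF// -val_eqE/= gtn_eqF.
  by rewrite -leqNgt ltn_neqAle -val_eqE.
have -> : \sum_i \sum_j g i j = 2 * \sum_(i < n) \sum_(j < n | (i < j)%N) g i j
    + \sum_i g i i.
  rewrite E; congr (_ + _); rewrite mulr_natl mulr2n; congr (_ + _).
  rewrite (exchange_big_dep xpredT)//=; apply: eq_bigr => i _.
  by apply: eq_bigr => j _.
by rewrite addrK.
Qed.

(** Each u_i^(q-1) is at most the (q-1)-th power of the sum. *)
Lemma sum_powR_le q n (u : 'I_n -> R) (P : pred 'I_n) : 1 <= q ->
  (forall i, 0 <= u i) -> \sum_(i | P i) u i `^ q <= (\sum_(i | P i) u i) `^ q.
Proof.
move=> q1 u0; set X := \sum_(i | P i) u i.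
have X0 : 0 <= X by rewrite sumr_ge0.
have q0 : 0 < q by exact: lt_le_trans q1.
rewrite -mulr_powRB1// {1}/X mulr_suml; apply: ler_sum => i Pi.
rewrite -mulr_powRB1//; apply: ler_wpM2l => //.
apply: ge0_ler_powR; rewrite ?nnegrE ?subr_ge0//.
by rewrite /X (bigD1 i)//= lerDl sumr_ge0.
Qed.

End energy_bound.

(** * Lower bounds for the energy from the simplex bound *)

Section energy_lower_bounds.
Context {R : realType}.
Variables (alpha a b m : R) (e : bool).
Hypotheses (al1 : 1 < alpha) (al2 : alpha < 2) (a0 : 0 < a) (b0 : 0 < b)
  (m0 : 0 < m).

Let g := 1 / (alpha - 1).
(** The boolean [e] tells whether positive diagonal entries are allowed; without them the diagonal
    cannot help and S = 0. *)
Let S := e%:R * (1 / b) `^ g.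
Let T := (2 / a) `^ g.

Let p0 : 0 < alpha - 1. Proof. by rewrite subr_gt0. Qed.
Let g0 : 0 < g. Proof. by rewrite divr_gt0. Qed.
Let g1 : 1 < g.
Proof. by rewrite /g ltr_pdivlMr// mul1r ltrBlDr. Qed.
Let q1 : 1 < (1 + g) / 2. Proof. by move: g1; lra. Qed.
Let S0 : 0 <= S. Proof. by rewrite mulr_ge0// powR_ge0. Qed.
Let T0 : 0 <= T. Proof. exact: powR_ge0. Qed.

(** Raising the hypothesis to the power g gives m^g L <= k^g, where L = S + (k-1)T. Since twice the
    exponent (1+g)/2 is 1 + g, the left side of the conclusion is L / k^g. *)
Let uniform_le k : (0 < k)%N ->
  m * (S + (k%:R - 1) * T) `^ (alpha - 1) <= k%:R ->
  k%:R * (S + (k%:R - 1) * T) * (k%:R^-1 `^ ((1 + g) / 2)) ^+ 2 <= (m `^ g)^-1.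
Proof.
move=> k0; have k1 : 1 <= k%:R :> R by rewrite ler1n.
have k0' : 0 < k%:R :> R by rewrite ltr0n.
set L := S + _; have L0 : 0 <= L by rewrite addr_ge0// mulr_ge0// subr_ge0.
move=> H.
have : (m * L `^ (alpha - 1)) `^ g <= k%:R `^ g.
  by rewrite ge0_ler_powR ?nnegrE// ?(ltW g0)// mulr_ge0 ?powR_ge0// ltW.
rewrite powRM ?powR_ge0 ?(ltW m0)// -powRrM.
have -> : (alpha - 1) * g = 1 by rewrite /g mulrC divfK ?gt_eqF.
rewrite powRr1// => {}H.
have -> : (k%:R^-1 `^ ((1 + g) / 2)) ^+ 2 = k%:R^-1 * (k%:R `^ g)^-1 :> R.
  rewrite -(powR_mulrn 2 (powR_ge0 _ _)) -powRrM divfK ?pnatr_eq0//.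
  rewrite powRD ?powRr1 ?invr_ge0 ?(ltW k0')//; last first.
    by apply/implyP => _; rewrite invr_eq0 gt_eqF.
  congr (_ * _); rewrite -(powR_inv1 (ltW k0')) -powRrM mulrC powRrM.
  by rewrite powR_inv1// powR_ge0.
have mg : 0 < m `^ g by exact: powR_gt0.
have kg : 0 < k%:R `^ g :> R by exact: powR_gt0.
rewrite mulrACA mulfV ?gt_eqF// mul1r ler_pdivrMr// mulrC ler_pdivlMr//.
by rewrite mulrC.
Qed.

Let sqr_powR (s : R) : 0 <= s -> (s ^+ 2) `^ ((1 + g) / 2) = s `^ (1 + g).
Proof. by move=> s0; rewrite -(powR_mulrn 2 s0) -powRrM mulrC divfK ?pnatr_eq0. Qed.

Let diag_powR (s : R) : 0 <= s ->
  (e%:R * s ^+ 2) `^ (1 + g) = e%:R * (s `^ (1 + g)) ^+ 2.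
Proof.
move=> s0; rewrite powRM ?sqr_ge0//; congr (_ * _).
  by case: e; rewrite ?powR1// powR0// gt_eqF// addr_gt0.
by rewrite -(powR_mulrn 2 s0) -(powR_mulrn 2 (powR_ge0 _ _)) -!powRrM mulrC.
Qed.

(** After [energy_young], the dual term is the quadratic form at u_i = s_i^2 with q = (1+g)/2,
    because (s_i s_j)^(1+g) = u_i^q u_j^q. *)
Lemma energy_ge_modulus n (D s : 'I_n -> R) (r : 'I_n -> 'I_n -> R) :
  (forall i, 0 <= D i) -> (forall i j, 0 <= r i j) -> (forall i, 0 <= s i) ->
  \sum_i s i ^+ 2 = 1 ->
  (forall k, (0 < k)%N -> m * (S + (k%:R - 1) * T) `^ (alpha - 1) <= k%:R) ->
  1 <= \sum_i D i * (e%:R * s i ^+ 2) +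
       2 * \sum_(i < n) \sum_(j < n | (i < j)%N) r i j * (s i * s j) ->
  m <= b * (\sum_i D i `^ alpha) +
       a * (\sum_(i < n) \sum_(j < n | (i < j)%N) r i j `^ alpha).
Proof.
move=> D0 r0 s0 s1 Hk X1.
apply: (energy_young al1 a0 b0 m0 D0 _ r0 _ X1).
- by move=> i; rewrite mulr_ge0// sqr_ge0.
- by move=> i j; rewrite mulr_ge0.
rewrite -/g -/T; have mg : 0 < m `^ g by exact: powR_gt0.
rewrite -ler_pdivlMl// mulr1.
have Hu k : (0 < k <= n)%N ->
    k%:R * (S + (k%:R - 1) * T) * (k%:R^-1 `^ ((1 + g) / 2)) ^+ 2 <= (m `^ g)^-1.
  by case/andP => k0 _; apply: uniform_le => //; exact: Hk.
have := simplex_power_bound q1 S0 T0 Hu (fun i => sqr_ge0 (s i)) s1.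
apply: le_trans.
under eq_bigr do rewrite diag_powR//.
under [X in _ + _ * X <= _]eq_bigr do under eq_bigr do rewrite powRM//.
under [X in _ <= _ * X ^+ 2 + _]eq_bigr do rewrite sqr_powR//.
under [X in _ <= _ + _ * X]eq_bigr do rewrite sqr_powR//.
have := sum_ltn_sym (g := fun i j => s i `^ (1 + g) * s j `^ (1 + g))
  (fun i j => mulrC _ _).
rewrite -big_distrlr/= -expr2.
under [in X in _ = _ - X -> _]eq_bigr do rewrite -expr2.
rewrite -mulr_sumr -(mulrA 2) (mulrCA 2) => ->.
by rewrite /S le_eqVlt; apply/orP; left; apply/eqP; ring.
Qed.

(** Only pairs of opposite signs interact. Superadditivity of powers allows each sign class to be
    replaced by one coordinate carrying its whole mass [U c], so sizes k <= 2 suffice. *)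
Lemma energy_ge_sign n (D s : 'I_n -> R) (r : 'I_n -> 'I_n -> R)
    (pos : 'I_n -> bool) :
  (forall i, 0 <= D i) -> (forall i j, 0 <= r i j) -> (forall i, 0 <= s i) ->
  \sum_i s i ^+ 2 = 1 ->
  (forall k, (0 < k <= 2)%N -> m * (S + (k%:R - 1) * T) `^ (alpha - 1) <= k%:R) ->
  1 <= \sum_i D i * (e%:R * s i ^+ 2) +
       2 * \sum_(i < n) \sum_(j < n | (i < j)%N)
              r i j * ((pos i != pos j)%:R * (s i * s j)) ->
  m <= b * (\sum_i D i `^ alpha) +
       a * (\sum_(i < n) \sum_(j < n | (i < j)%N) r i j `^ alpha).
Proof.
move=> D0 r0 s0 s1 Hk X1.
apply: (energy_young al1 a0 b0 m0 D0 _ r0 _ X1).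
- by move=> i; rewrite mulr_ge0// sqr_ge0.
- by move=> i j; rewrite !mulr_ge0.
rewrite -/g -/T; have mg : 0 < m `^ g by exact: powR_gt0.
rewrite -ler_pdivlMl// mulr1.
pose U c := \sum_(i | pos i == c) s i ^+ 2.
have U0 c : 0 <= U c by apply: sumr_ge0 => i _; exact: sqr_ge0.
have U1 : U true + U false = 1.
  rewrite -s1 [RHS](bigID pos)/= /U.
  by congr (_ + _); apply: eq_bigl => i; case: (pos i).
pose u (i : 'I_2) := U (i == 0).
have u1 : \sum_i u i = 1 by rewrite !big_ord_recl big_ord0 addr0.
have Hu k : (0 < k <= 2)%N ->
    k%:R * (S + (k%:R - 1) * T) * (k%:R^-1 `^ ((1 + g) / 2)) ^+ 2 <= (m `^ g)^-1.
  by move=> /[dup] /andP[k0 _] k2; apply: uniform_le => //; exact: Hk.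
have := simplex_power_bound q1 S0 T0 Hu (fun i => U0 _ : 0 <= u i) u1.
apply: le_trans.
rewrite !big_ord_recl !big_ord0 !addr0 /u /=.
pose V c := \sum_(i | pos i == c) s i `^ (1 + g).
have V0 c : 0 <= V c by apply: sumr_ge0 => i _; exact: powR_ge0.
have VU c : V c <= U c `^ ((1 + g) / 2).
  rewrite /V; under eq_bigr do rewrite -sqr_powR//.
  by apply: sum_powR_le; [exact: ltW|move=> i; exact: sqr_ge0].
have V2 c : \sum_(i | pos i == c) (s i `^ (1 + g)) ^+ 2 <= V c ^+ 2.
  rewrite -(powR_mulrn 2 (V0 c)).
  under eq_bigr do rewrite -(powR_mulrn 2 (powR_ge0 _ _)).
  by apply: sum_powR_le; rewrite ?ler1n// => i; exact: powR_ge0.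
under eq_bigr do rewrite diag_powR//.
rewrite -mulr_sumr mulrA (mulrC _ e%:R) -/S.
have -> : 2 * T * (\sum_(i < n) \sum_(j < n | (i < j)%N)
    ((pos i != pos j)%:R * (s i * s j)) `^ (1 + g)) = 2 * T * (V true * V false).
  (* Splitting the indicator of opposite signs into two products makes the double sum factor into
     the class sums [V true] and [V false]; the diagonal contributes nothing. *)
  have E i j : ((pos i != pos j)%:R * (s i * s j)) `^ (1 + g) =
     (pos i)%:R * s i `^ (1 + g) * ((~~ pos j)%:R * s j `^ (1 + g)) +
     (~~ pos i)%:R * s i `^ (1 + g) * ((pos j)%:R * s j `^ (1 + g)).
    rewrite powRM ?mulr_ge0// powRM//.
    have g10 : 1 + g != 0 by rewrite gt_eqF// addr_gt0.
    case: (pos i); case: (pos j) => /=;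
      rewrite ?powR0 ?powR1 ?mul0r ?mulr0 ?mul1r ?addr0 ?add0r//.
  rewrite mulrAC; under eq_bigr do under eq_bigr do rewrite E.
  rewrite sum_ltn_sym; last by move=> i j; ring.
  under [X in _ - X]eq_bigr do rewrite mulrACA [X in _ + X]mulrACA -!natrM.
  rewrite [X in _ - X]big1 ?subr0; last first.
    by move=> i _; case: (pos i); rewrite !mul0r addr0.
  under eq_bigr do rewrite big_split/=.
  rewrite big_split/= -!big_distrlr/=.
  have W1 : \sum_i (pos i)%:R * s i `^ (1 + g) = V true.
    rewrite /V [RHS]big_mkcond; apply: eq_bigr => i _.
    by case: (pos i); rewrite ?mul1r ?mul0r.
  have W2 : \sum_i (~~ pos i)%:R * s i `^ (1 + g) = V false.
    rewrite /V [RHS]big_mkcond; apply: eq_bigr => i _.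
    by case: (pos i); rewrite ?mul1r ?mul0r.
  by rewrite W1 W2; ring.
rewrite (bigID pos)/=.
have VT := V2 true; have VF := V2 false.
rewrite (eq_bigl pos) in VT; last by move=> i; case: (pos i).
rewrite (eq_bigl (fun i => ~~ pos i)) in VF; last by move=> i; case: (pos i).
move: (VU true) (VU false) (V0 true) (V0 false) VT VF.
move: (U true `^ _) (U false `^ _) (V true) (V false) => X Y x y xX yY x0 y0 xx yy.
have xX2 : x ^+ 2 <= X ^+ 2 by rewrite lerXn2r ?nnegrE// (le_trans x0).
have yY2 : y ^+ 2 <= Y ^+ 2 by rewrite lerXn2r ?nnegrE// (le_trans y0).
have -> : T * (X + Y) ^+ 2 + (S - T) * (X ^+ 2 + Y ^+ 2) =
   S * (X ^+ 2 + Y ^+ 2) + 2 * T * (X * Y) by ring.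
apply: lerD.
  by rewrite ler_wpM2l// lerD// (le_trans _ xX2, le_trans _ yY2).
by rewrite ler_wpM2l ?mulr_ge0// ler_pM.
Qed.

End energy_lower_bounds.

(** * Hermitian matrices and their eigenvectors *)

Section complex_forms.
Context {R : realType}.
Implicit Types z w : R[i].

Lemma modulusE z : modulus z = Num.sqrt (complex.Re z ^+ 2 + complex.Im z ^+ 2).
Proof. by rewrite /modulus normc_def. Qed.

Lemma normC_modulus z : `|z| = (modulus z)%:C.
Proof. by rewrite modulusE normc_def. Qed.

Lemma modulus_ge0 z : 0 <= modulus z.
Proof. by rewrite modulusE sqrtr_ge0. Qed.

Lemma sqr_modulus z : modulus z ^+ 2 = complex.Re z ^+ 2 + complex.Im z ^+ 2.
Proof. by rewrite modulusE sqr_sqrtr// addr_ge0 ?sqr_ge0. Qed.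

Lemma modulusM z w : modulus (z * w) = modulus z * modulus w.
Proof.
apply: complexI; rewrite -normC_modulus normrM !normC_modulus.
by rewrite rmorphM.
Qed.

Lemma modulus_eq0 z : (modulus z == 0) = (z == 0).
Proof. by rewrite -(normr_eq0 z) normC_modulus -(inj_eq (@complexI R)). Qed.

Lemma modulus_conj z : modulus z^* = modulus z.
Proof. by case: z => x y; rewrite !modulusE/= sqrrN. Qed.

Lemma modulus_real (x : R) : modulus x%:C = `|x|.
Proof. by rewrite modulusE/= expr0n addr0 sqrtr_sqr. Qed.

Lemma Re_le_modulus z : complex.Re z <= modulus z.
Proof.
apply: le_trans (ler_norm _) _; rewrite -sqrtr_sqr modulusE ler_wsqrtr//.
by rewrite lerDl sqr_ge0.
Qed.

Lemma le_modulus_sum n (f : 'I_n -> R[i]) :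
  modulus (\sum_i f i) <= \sum_i modulus (f i).
Proof.
rewrite -lecR -normC_modulus rmorph_sum/=; apply: le_trans (ler_norm_sum _ _ _) _.
by apply: ler_sum => i _; rewrite normC_modulus.
Qed.

Lemma Re_sum n (f : 'I_n -> R[i]) :
  complex.Re (\sum_i f i) = \sum_i complex.Re (f i).
Proof. by elim/big_rec2: _ => [//|i y1 y2 _ <-]; case: (f i) => ? ?; case: y2. Qed.

Lemma hermsymmxP n (A : 'M[R[i]]_n) :
  reflect (forall i j, A i j = (A j i)^*) (A \is hermsymmx).
Proof.
apply: (iffP (is_hermitianmxP _ _ _)); rewrite expr0 scale1r.
  by move=> AE i j; rewrite {1}AE !mxE.
by move=> AE; apply/matrixP => i j; rewrite !mxE AE.
Qed.

(** The real part of the pairing of v A = v with v; the terms (i,j) and (j,i) are conjugate, so they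
    merge. *)
Lemma eigen_form n (A : 'M[R[i]]_n) (v : 'rV[R[i]]_n) :
  A \is hermsymmx -> v *m A = v ->
  \sum_i modulus (v 0 i) ^+ 2 =
  \sum_i complex.Re (A i i) * modulus (v 0 i) ^+ 2 +
  2 * \sum_(i < n) \sum_(j < n | (i < j)%N) complex.Re (v 0 i * A i j * (v 0 j)^*).
Proof.
move=> /hermsymmxP Ah vA.
rewrite (sum_ltn_sym (g := fun i j => complex.Re (v 0 i * A i j * (v 0 j)^*))); last first.
  move=> i j; rewrite Ah; case: (A j i) (v 0 i) (v 0 j) => [p q] [x y] [x' y'] /=.
  by ring.
have -> : \sum_i \sum_j complex.Re (v 0 i * A i j * (v 0 j)^*) =
    \sum_j modulus (v 0 j) ^+ 2.
  rewrite exchange_big/=; apply: eq_bigr => j _; rewrite -Re_sum -mulr_suml.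
  have -> : \sum_i v 0 i * A i j = v 0 j by rewrite -[in RHS]vA mxE.
  by rewrite sqr_modulus; case: (v 0 j) => x y /=; ring.
have -> : \sum_i complex.Re (v 0 i * A i i * (v 0 i)^*) =
    \sum_i complex.Re (A i i) * modulus (v 0 i) ^+ 2.
  apply: eq_bigr => i _; rewrite sqr_modulus.
  have := Ah i i; case: (A i i) (v 0 i) => [p q] [x y] /= [] qE.
  have {qE} -> : q = 0 by lra.
  by ring.
by rewrite addrC subrK.
Qed.

End complex_forms.

(** * Energy bounds for Hermitian matrices with eigenvalue 1 *)

Section admissible_bounds.
Context {R : realType}.
Implicit Types (alpha a b m : R) (nu : probability (borelC R) R).

(** Here s is the vector of moduli of v divided by its Euclidean norm. The weights w serve both the
    plain modulus bound (w = 1) and the one that keeps only pairs of opposite signs. *)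
Lemma eigen_modulus_le n (A : 'M[R[i]]_n) (v : 'rV[R[i]]_n)
    (w : 'I_n -> 'I_n -> R) :
  A \is hermsymmx -> v *m A = v -> v != 0 ->
  (forall i j : 'I_n, (i < j)%N -> complex.Re (v 0 i * A i j * (v 0 j)^*) <=
     modulus (A i j) * (w i j * (modulus (v 0 i) * modulus (v 0 j)))) ->
  exists s : 'I_n -> R, [/\ forall i, 0 <= s i, \sum_i s i ^+ 2 = 1
    & 1 <= \sum_i complex.Re (A i i) * s i ^+ 2 +
       2 * \sum_(i < n) \sum_(j < n | (i < j)%N)
              modulus (A i j) * (w i j * (s i * s j))].
Proof.
move=> Ah vA v0 Hw.
pose N := \sum_i modulus (v 0 i) ^+ 2.
have N0 : 0 < N.
  rewrite lt0r sumr_ge0 ?andbT; last by move=> i _; exact: sqr_ge0.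
  apply: contra_neq v0 => /eqP; rewrite psumr_eq0; last by move=> i _; exact: sqr_ge0.
  move=> /allP h; apply/rowP => i; rewrite mxE.
  have := h i (mem_index_enum _); rewrite /= sqrf_eq0 modulus_eq0.
  by move/eqP.
have [t t0 t2] : exists2 t, 0 < t & t ^+ 2 = N.
  by exists (Num.sqrt N); rewrite ?sqrtr_gt0// sqr_sqrtr// ltW.
exists (fun i => modulus (v 0 i) / t); split.
- by move=> i; rewrite divr_ge0 ?modulus_ge0// ltW.
- under eq_bigr do rewrite expr_div_n t2.
  by rewrite -mulr_suml divff// gt_eqF.
- rewrite -[X in X <= _](divff (lt0r_neq0 N0)) {1}/N (eigen_form Ah vA) mulrDl.
  apply: lerD.
    rewrite mulr_suml; apply: ler_sum => i _.
    by rewrite expr_div_n t2 -mulrA.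
  rewrite -mulrA ler_wpM2l// mulr_suml; apply: ler_sum => i _.
  rewrite mulr_suml; apply: ler_sum => j ij.
  rewrite ler_pdivrMr//; apply: le_trans (Hw _ _ ij) _.
  rewrite le_eqVlt; apply/orP; left; apply/eqP; rewrite -[in RHS]t2.
  by field; rewrite gt_eqF.
Qed.

Lemma eigen_modulus n (A : 'M[R[i]]_n) :
  A \is hermsymmx -> eigenvalue A (1 : R)%:C ->
  exists s : 'I_n -> R, [/\ forall i, 0 <= s i, \sum_i s i ^+ 2 = 1
    & 1 <= \sum_i complex.Re (A i i) * s i ^+ 2 +
       2 * \sum_(i < n) \sum_(j < n | (i < j)%N) modulus (A i j) * (s i * s j)].
Proof.
move=> Ah /eigenvalueP[v]; rewrite scale1r => vA v0.
have [|s [s0 s1 H]] := @eigen_modulus_le n A v (fun _ _ => 1) Ah vA v0.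
  move=> i j _; apply: le_trans (Re_le_modulus _) _.
  by rewrite !modulusM modulus_conj mul1r mulrCA mulrA.
exists s; split=> //; apply: le_trans H _; rewrite lerD2l ler_wpM2l//.
by apply: ler_sum => i _; apply: ler_sum => j _; rewrite mul1r.
Qed.

(* Here A is real, so its eigenvector can be taken real, with signs [pos]; only
   pairs of coordinates of opposite signs contribute positively. *)
Lemma eigen_sign n (A : 'M[R[i]]_n) :
  A \is hermsymmx -> eigenvalue A (1 : R)%:C ->
  (forall i j : 'I_n, (i < j)%N -> A i j = (- modulus (A i j))%:C) ->
  exists (s : 'I_n -> R) (pos : 'I_n -> bool),
    [/\ forall i, 0 <= s i, \sum_i s i ^+ 2 = 1
    & 1 <= \sum_i complex.Re (A i i) * s i ^+ 2 +
       2 * \sum_(i < n) \sum_(j < n | (i < j)%N)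
              modulus (A i j) * ((pos i != pos j)%:R * (s i * s j))].
Proof.
move=> Ah /eigenvalueP[v]; rewrite scale1r => vA v0 An.
have AR i j : A i j = (complex.Re (A i j))%:C.
  have /hermsymmxP Ac := Ah.
  case: (ltngtP i j) => [ij|ij|/val_inj ij].
  - by rewrite (An _ _ ij).
  - by rewrite Ac (An _ _ ij) conjc_real.
  - rewrite ij; have := Ac j j; case: (A j j) => x y /= [] yE.
    by have -> : y = 0 by lra.
(* As A is real, it fixes both the real and the imaginary part of v, and one of them is nonzero; f
   takes that part. *)
have [f [fD fM fv]] : exists f : R[i] -> R,
  [/\ {morph f : x y / x + y}, forall x (r : R), f (x * r%:C) = f x * r
    & \row_i (f (v 0 i))%:C != 0 :> 'rV[R[i]]_n].
  have [h|h] := eqVneq (\row_i (complex.Re (v 0 i))%:C) (0 : 'rV[R[i]]_n).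
    exists (@complex.Im R); split.
    - by case=> ? ? [].
    - by case=> x y r /=; ring.
    - apply: contra_neq v0 => h'; apply/rowP => i.
      move/rowP/(_ i) : h; move/rowP/(_ i) : h'; rewrite !mxE => -[] E1 [] E2.
      by rewrite (complexE (v 0 i)) E1 E2 mulr0 addr0.
  exists (@complex.Re R); split => //.
  - by case=> ? ? [].
  - by case=> x y r /=; ring.
pose w : 'rV[R[i]]_n := \row_i (f (v 0 i))%:C.
have wA : w *m A = w.
  apply/rowP => j; rewrite !mxE.
  have f0 : f 0 = 0 by apply: (addrI (f 0)); rewrite -fD !addr0.
  rewrite -[in RHS]vA mxE (big_morph f fD f0) rmorph_sum; apply: eq_bigr => i _.
  by rewrite mxE [in RHS]AR fM rmorphM/= -AR.
pose pos i := 0 <= f (v 0 i).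
have [|s [s0 s1 H]] := @eigen_modulus_le n A w (fun i j => (pos i != pos j)%:R) Ah wA fv.
  move=> i j ij; rewrite !mxE {1}(An _ _ ij) !modulus_real /= /pos.
  move: (modulus_ge0 (A i j)); move: (modulus (A i j)) => r r0.
  move: (f (v 0 i)) (f (v 0 j)) => x y.
  have -> : (x * - r - 0 * 0) * y - (x * 0 + 0 * - r) * - 0 = r * (- (x * y)) by ring.
  apply: ler_wpM2l => //.
  have [x0|x0] := leP 0 x; have [y0|y0] := leP 0 y; rewrite /= ?mul0r ?mul1r.
  - by rewrite oppr_le0 mulr_ge0.
  - by rewrite (ger0_norm x0) (ltr0_norm y0) mulrN.
  - by rewrite (ger0_norm y0) (ltr0_norm x0) mulNr.
  - by rewrite oppr_le0 nmulr_rge0// ltW.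
by exists s, pos.
Qed.

Lemma Re_diag_bound n (A : 'M[R[i]]_n) (e : bool) (s : 'I_n -> R) :
  (forall i, e \/ complex.Re (A i i) <= 0) ->
  \sum_i complex.Re (A i i) * s i ^+ 2 <=
  \sum_i modulus (A i i) * (e%:R * s i ^+ 2).
Proof.
move=> He; apply: ler_sum => i _.
case: (He i) => [->|h].
  by rewrite mul1r ler_wpM2r ?sqr_ge0// Re_le_modulus.
apply: (@le_trans _ _ 0); first by rewrite mulr_le0_ge0 ?sqr_ge0.
by apply: mulr_ge0 (modulus_ge0 _) (mulr_ge0 _ (sqr_ge0 _)); rewrite ler0n.
Qed.

Lemma energy_ge_general alpha a b m (e : bool) n (A : 'M[R[i]]_n) :
  1 < alpha -> alpha < 2 -> 0 < a -> 0 < b -> 0 < m ->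
  A \is hermsymmx -> eigenvalue A (1 : R)%:C ->
  (forall i, e \/ complex.Re (A i i) <= 0) ->
  (forall k, (0 < k)%N -> m * (e%:R * (1 / b) `^ (1 / (alpha - 1)) +
     (k%:R - 1) * (2 / a) `^ (1 / (alpha - 1))) `^ (alpha - 1) <= k%:R) ->
  m <= energy alpha a b A.
Proof.
move=> al1 al2 a0 b0 m0 Ah Ae He Hk.
have [s [s0 s1 H]] := eigen_modulus Ah Ae.
apply: (energy_ge_modulus al1 al2 a0 b0 m0 _ _ s0 s1 Hk).
- by move=> i; exact: modulus_ge0.
- by move=> i j; exact: modulus_ge0.
- by apply: le_trans H _; rewrite lerD2r; exact: Re_diag_bound.
Qed.

Lemma energy_ge_negative alpha a b m (e : bool) n (A : 'M[R[i]]_n) :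
  1 < alpha -> alpha < 2 -> 0 < a -> 0 < b -> 0 < m ->
  A \is hermsymmx -> eigenvalue A (1 : R)%:C ->
  (forall i j : 'I_n, (i < j)%N -> A i j = (- modulus (A i j))%:C) ->
  (forall i, e \/ complex.Re (A i i) <= 0) ->
  (forall k, (0 < k <= 2)%N -> m * (e%:R * (1 / b) `^ (1 / (alpha - 1)) +
     (k%:R - 1) * (2 / a) `^ (1 / (alpha - 1))) `^ (alpha - 1) <= k%:R) ->
  m <= energy alpha a b A.
Proof.
move=> al1 al2 a0 b0 m0 Ah Ae An He Hk.
have [s [pos [s0 s1 H]]] := eigen_sign Ah Ae An.
apply: (energy_ge_sign (pos := pos) al1 al2 a0 b0 m0 _ _ s0 s1 Hk).
- by move=> i; exact: modulus_ge0.
- by move=> i j; exact: modulus_ge0.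
- by apply: le_trans H _; rewrite lerD2r; exact: Re_diag_bound.
Qed.

(** A diagonal entry with positive real part and modulus at least 1 already costs b, and an
    off-diagonal entry of modulus at least 1 costs a. Otherwise x <= x^alpha for every modulus that
    matters, and the coefficients s_i^2 and 2 s_i s_j are at most 1. *)
Lemma energy_ge_concave alpha a b m n (A : 'M[R[i]]_n) :
  0 < alpha <= 1 -> 0 < a -> 0 < b -> 0 < m -> m <= a ->
  A \is hermsymmx -> eigenvalue A (1 : R)%:C ->
  (forall i, m <= b \/ complex.Re (A i i) <= 0) ->
  m <= energy alpha a b A.
Proof.
move=> /andP[al0 al1] a0 b0 m0 ma Ah Ae He.
have dg0 : 0 <= \sum_i modulus (A i i) `^ alpha.
  by apply: sumr_ge0 => i _; exact: powR_ge0.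
have od0 : 0 <= \sum_(i < n) \sum_(j < n | (i < j)%N) modulus (A i j) `^ alpha.
  by apply: sumr_ge0 => i _; apply: sumr_ge0 => j _; exact: powR_ge0.
have [s [s0 s1 H]] := eigen_modulus Ah Ae.
have one : 1 = 1 `^ alpha :> R by rewrite powR1.
have big1 x : 1 <= x -> 1 <= x `^ alpha.
  by move=> x1; rewrite one ge0_ler_powR ?nnegrE// ?(le_trans _ x1)// ltW.
have small x : 0 <= x -> x <= 1 -> x <= x `^ alpha.
  rewrite le_eqVlt => /predU1P[<- _|x0 x1]; first exact: powR_ge0.
  by apply: ger1_powR => //; rewrite x0.
have [/existsP[i /andP[i0 i1]]|] :=
    boolP [exists i, (0 < complex.Re (A i i)) && (1 <= modulus (A i i))].
  have mb : m <= b by case: (He i) => // /le_lt_trans/(_ i0); rewrite ltxx.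
  apply: (@le_trans _ _ (b * 1)); first by rewrite mulr1.
  rewrite /energy -[leLHS]addr0; apply: lerD; last by rewrite mulr_ge0// ltW.
  rewrite ler_pM2l// (bigD1 i)//=; apply: (le_trans (big1 _ i1)).
  by rewrite lerDl sumr_ge0// => j _; exact: powR_ge0.
rewrite negb_exists => /forallP hd.
have [/existsP[i /existsP[j /andP[ij i1]]]|] :=
    boolP [exists i : 'I_n, exists j : 'I_n, (i < j)%N && (1 <= modulus (A i j))].
  apply: (@le_trans _ _ (a * 1)); first by rewrite mulr1.
  rewrite /energy -[leLHS]add0r; apply: lerD; first by rewrite mulr_ge0// ltW.
  rewrite ler_pM2l// (bigD1 i)//= (bigD1 j)//= -addrA; apply: (le_trans (big1 _ i1)).
  rewrite lerDl addr_ge0//; first by apply: sumr_ge0 => ? _; exact: powR_ge0.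
  by apply: sumr_ge0 => ? _; apply: sumr_ge0 => ? _; exact: powR_ge0.
rewrite negb_exists => /forallP ho.
have s11 i : s i ^+ 2 <= 1.
  rewrite -s1 (bigD1 i)//= lerDl; apply: sumr_ge0 => j _; exact: sqr_ge0.
have s12 (i j : 'I_n) : (i < j)%N -> 2 * (s i * s j) <= 1.
  move=> ij; apply: (@le_trans _ _ (s i ^+ 2 + s j ^+ 2)).
    by rewrite -subr_ge0; have := sqr_ge0 (s i - s j); rewrite sqrrB; lra.
  rewrite -s1 (bigD1 i)//= (bigD1 j)/=; last by rewrite -val_eqE/= gtn_eqF.
  by rewrite addrA lerDl; apply: sumr_ge0 => k _; exact: sqr_ge0.
rewrite -[leLHS]mulr1; apply: (le_trans (ler_wpM2l (ltW m0) H)).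
rewrite mulrDr; apply: lerD; rewrite mulr_sumr.
  rewrite mulr_sumr; apply: ler_sum => i _.
  have [h|h] := leP (complex.Re (A i i)) 0.
    apply: (@le_trans _ _ 0); last by rewrite mulr_ge0 ?powR_ge0// ltW.
    by rewrite pmulr_rle0// mulr_le0_ge0// sqr_ge0.
  have mb : m <= b by case: (He i) => // /le_lt_trans/(_ h); rewrite ltxx.
  have := hd i; rewrite h /= -ltNge => /ltW A1.
  apply: ler_pM => //; rewrite ?(ltW m0)//.
    by rewrite mulr_ge0 ?sqr_ge0// ltW.
  apply: le_trans (small _ (modulus_ge0 _) A1).
  rewrite -[leRHS]mulr1; apply: ler_pM; rewrite ?sqr_ge0 ?(ltW h)//.
  exact: Re_le_modulus.
rewrite !mulr_sumr; apply: ler_sum => i _.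
rewrite !mulr_sumr; apply: ler_sum => j ij.
have := ho i; rewrite negb_exists => /forallP/(_ j); rewrite ij /= -ltNge => /ltW A1.
apply: ler_pM => //; rewrite ?(ltW m0)//.
  by rewrite !mulr_ge0 ?modulus_ge0.
apply: le_trans (small _ (modulus_ge0 _) A1).
rewrite mulrCA -[leRHS]mulr1; apply: ler_pM; rewrite ?modulus_ge0 ?mulr_ge0//.
exact: s12.
Qed.

(** Diagonal entries of a Hermitian matrix are real, so a positive one has direction 1. *)
Lemma admissible_diag_le0 nu1 nu2 n (A : 'M[R[i]]_n) i :
  admissible nu1 nu2 A -> ~ msupport nu1 1 -> complex.Re (A i i) <= 0.
Proof.
move=> [/hermsymmxP Ah /(_ i i (leqnn _))]; rewrite eqxx => Ai N1.
rewrite leNgt; apply/negP => A0; apply: N1.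
have AE : A i i = `|A i i|.
  have := Ah i i; rewrite normC_modulus modulusE; case: (A i i) A0 => x y /= x0 [] yE.
  have -> : y = 0 by lra.
  by rewrite expr0n addr0 sqrtr_sqr gtr0_norm.
have An0 : A i i != 0 by apply: contraTneq A0 => ->; rewrite ltxx.
case: Ai => [/eqP|]; first by rewrite (negbTE An0).
by rewrite -AE divff.
Qed.

Lemma admissible_offdiag_neg nu1 nu2 n (A : 'M[R[i]]_n) (i j : 'I_n) :
  admissible nu1 nu2 A -> msupport nu2 = [set -1] -> (i < j)%N ->
  A i j = (- modulus (A i j))%:C.
Proof.
move=> [_ Aij] N2 ij; have := Aij i j (ltnW ij).
rewrite -val_eqE/= ltn_eqF// N2 rmorphN/= -normC_modulus.
case=> [->|]; first by rewrite normr0 oppr0.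
have [->|A0] := eqVneq (A i j) 0; first by rewrite normr0 oppr0.
by move=> /= /(canRL (divfK _)) ->; rewrite ?mulN1r ?normr_eq0// normrN normr_id.
Qed.

End admissible_bounds.

(** * Extremal matrices *)

Section witnesses.
Context {R : realType}.
Implicit Types (alpha a b s t : R) (z : R[i]) (nu : probability (borelC R) R).

(** The fixed vector shows that 1 is an eigenvalue. The bound on the sums of moduli keeps A from
    increasing the l^1 norm, so no real eigenvalue exceeds 1. *)
Lemma largest_eigenvalue1 n (A : 'M[R[i]]_n) (v : 'rV[R[i]]_n) :
  v *m A = v -> v != 0 -> (forall j, \sum_i modulus (A i j) <= 1) ->
  (forall i j, modulus (A i j) = modulus (A j i)) ->
  largest_eigenvalue A 1.
Proof.
move=> vA v0 A1 Asym; split; first by apply/eigenvalueP; exists v; rewrite ?scale1r.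
move=> m /eigenvalueP[w wA w0].
pose N := \sum_i modulus (w 0 i).
have N0 : 0 < N.
  rewrite lt0r sumr_ge0 ?andbT; last by move=> i _; exact: modulus_ge0.
  apply: contra_neq w0 => /eqP; rewrite psumr_eq0; last by move=> i _; exact: modulus_ge0.
  move=> /allP h; apply/rowP => i; rewrite mxE.
  by have := h i (mem_index_enum _); rewrite /= modulus_eq0 => /eqP.
rewrite -(ler_pM2r N0) mul1r; apply: (@le_trans _ _ (`|m| * N)).
  by rewrite ler_wpM2r ?ler_norm// ltW.
rewrite /N mulr_sumr.
apply: (@le_trans _ _ (\sum_j \sum_i modulus (w 0 i) * modulus (A i j))).
  apply: ler_sum => j _; rewrite -modulus_real -modulusM.
  have -> : m%:C * w 0 j = \sum_i w 0 i * A i j.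
    by move/rowP/(_ j) : wA; rewrite !mxE => <-.
  apply: le_trans (le_modulus_sum _) _.
  by apply: ler_sum => i _; rewrite modulusM.
rewrite exchange_big/=; apply: ler_sum => i _.
rewrite -mulr_sumr -[leRHS]mulr1 ler_wpM2l ?modulus_ge0//.
by under eq_bigr do rewrite Asym.
Qed.

Lemma energy_const alpha a b n (A : 'M[R[i]]_n) x y :
  (forall i, modulus (A i i) = x) ->
  (forall i j : 'I_n, (i < j)%N -> modulus (A i j) = y) ->
  energy alpha a b A =
  n%:R * (b * x `^ alpha + a / 2 * (n%:R - 1) * y `^ alpha).
Proof.
move=> Ax Ay; rewrite /energy; under eq_bigr do rewrite Ax.
under [X in _ + _ * X]eq_bigr do under eq_bigr => j ij do rewrite (Ay _ _ ij).
have c (u : R) : \sum_(i < n) u = n%:R * u.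
  by rewrite sumr_const card_ord mulr_natl.
have := sum_ltn_sym (g := fun _ _ : 'I_n => y `^ alpha) (fun _ _ => erefl).
set Z := \sum_(i < n) \sum_(j < n | _) _; rewrite !c => E.
have -> : Z = (n%:R * (n%:R * y `^ alpha) - n%:R * y `^ alpha) / 2 by rewrite -E; field.
by field.
Qed.

Lemma modulus_Bmx n s t (i j : 'I_n) : 0 <= s -> 0 <= t ->
  0 < s + (n%:R - 1) * t ->
  modulus (Bmx n s t i j) = (if i == j then s else t) / (s + (n%:R - 1) * t).
Proof.
move=> s0 t0 L0; rewrite mxE modulus_real ger0_norm//.
by rewrite divr_ge0// ?(ltW L0)//; case: ifP.
Qed.

Lemma Bmx_sum n s t (j : 'I_n) : s + (n%:R - 1) * t != 0 ->
  \sum_i (if i == j then s else t) / (s + (n%:R - 1) * t) = 1.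
Proof.
move=> L0; rewrite -mulr_suml (bigD1 j)//= eqxx.
rewrite (eq_bigr (fun=> t)); last by move=> i /negbTE ->.
rewrite sumr_const cardC1 card_ord -[_ *+ _]mulr_natl.
have -> : n.-1%:R = n%:R - 1 :> R.
  by case: n j L0 => [[]//|n] _ _; rewrite -[in RHS]addn1 natrD addrK.
by rewrite divff.
Qed.

(** The all-ones vector is fixed since every column sums to 1. Support conditions are imposed only
    where nonzero diagonal entries, or off-diagonal positions, exist. *)
Lemma Bmx_feasible nu1 nu2 n s t : (0 < n)%N -> 0 <= s -> 0 <= t ->
  0 < s + (n%:R - 1) * t ->
  (s != 0 -> msupport nu1 1) -> ((1 < n)%N -> msupport nu2 1) ->
  admissible nu1 nu2 (Bmx n s t) /\ largest_eigenvalue (Bmx n s t) 1.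
Proof.
move=> n0 s0 t0 L0 h1 h2; split.
  split.
    by apply/hermsymmxP => i j; rewrite !mxE (eq_sym j); exact/esym/conjc_real.
  move=> i j ij; set B := Bmx n s t i j.
  have BE : `|B| = B.
    by rewrite normC_modulus modulus_Bmx// /B mxE.
  have [->|B0] := eqVneq B 0; [by left|right]; rewrite BE divff//.
  move: B0; rewrite /B mxE; case: (eqVneq i j) => [_|nij] B0.
    by apply: h1; apply: contra_neq B0 => ->; rewrite mul0r.
  apply: h2; case: n n0 i j ij nij {B BE B0} L0 => [|[|n]]// _ i j _.
  by rewrite !ord1 eqxx.
apply: (@largest_eigenvalue1 _ _ (const_mx 1)).
- apply/rowP => j; rewrite !mxE; under eq_bigr do rewrite !mxE mul1r.
  by rewrite -rmorph_sum/= Bmx_sum ?gt_eqF.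
- case: n n0 L0 {h2} => // n _ _; apply/eqP => /rowP/(_ ord0); rewrite !mxE.
  by apply/eqP; rewrite oner_eq0.
- move=> j; under eq_bigr do rewrite modulus_Bmx//.
  by rewrite Bmx_sum ?gt_eqF.
- by move=> i j; rewrite !modulus_Bmx// eq_sym.
Qed.

Let realC_neq0 (x : R) : x != 0 -> x%:C != 0 :> R[i].
Proof. by apply: contra_neq => -[]. Qed.

(** For |z| = 1 this is [Bmx 2 s t] conjugated by a diagonal unitary matrix, with fixed row vector
    (1, z). The off-diagonal direction can thus be any point of the support of [nu2]. *)
Definition pairmx s t z : 'M[R[i]]_2 :=
  \matrix_(i, j) (if i == j then (s / (s + t))%:C
                  else (t / (s + t))%:C * (if (i < j)%N then z else z^*)).

Lemma modulus_pairmx s t z (i j : 'I_2) : 0 <= s -> 0 <= t -> 0 < s + t ->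
  modulus z = 1 ->
  modulus (pairmx s t z i j) = (if i == j then s else t) / (s + t).
Proof.
move=> s0 t0 L0 z1; rewrite mxE.
case: ifP => _; first by rewrite modulus_real ger0_norm// divr_ge0// ltW.
rewrite modulusM modulus_real ger0_norm ?divr_ge0 ?(ltW L0)//.
by case: ifP; rewrite ?modulus_conj z1 mulr1.
Qed.

Lemma pairmx_feasible nu1 nu2 s t z : 0 <= s -> 0 < t -> modulus z = 1 ->
  (s != 0 -> msupport nu1 1) -> msupport nu2 z ->
  admissible nu1 nu2 (pairmx s t z) /\ largest_eigenvalue (pairmx s t z) 1.
Proof.
move=> s0 t0 z1 h1 h2; have L0 : 0 < s + t by exact: ltr_wpDl.
have zz : z * z^* = 1.
  have := congr1 (fun x => x ^+ 2) z1; rewrite sqr_modulus expr1n.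
  by case: z {z1 h2} => x y /= E; apply/eqP; rewrite eq_complex/= -E; apply/andP; split;
     apply/eqP; ring.
split.
  split.
    apply/hermsymmxP => i j; rewrite !mxE (eq_sym j).
    case: (eqVneq i j) => [_|ij]; first exact/esym/conjc_real.
    rewrite [RHS]rmorphM/=; congr (_ * _); first exact/esym/conjc_real.
    case: (ltngtP i j) => [_|_|/val_inj E].
    - exact/esym/conjcK.
    - by [].
    - by rewrite E eqxx in ij.
  move=> i j ij; rewrite normC_modulus modulus_pairmx// ?ltW// mxE.
  case: (eqVneq i j) => [_|nij].
    have [->|sn0] := eqVneq s 0; [by left; rewrite mul0r|right].
    rewrite divff; first exact: h1.
    by apply: realC_neq0; rewrite mulf_neq0// invr_eq0 gt_eqF.
  have -> : (i < j)%N by rewrite ltn_neqAle ij andbT.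
  right; rewrite mulrAC divff ?mul1r//.
  by apply: realC_neq0; rewrite mulf_neq0 ?invr_eq0 ?gt_eqF.
have sumE : (s / (s + t))%:C + (t / (s + t))%:C = 1.
  by rewrite -rmorphD/= -mulrDl divff ?gt_eqF.
apply: (@largest_eigenvalue1 _ _ (\row_(i < 2) if i == 0 then 1 else z)).
- apply/rowP => j; rewrite !mxE !big_ord_recl big_ord0 !mxE /= addr0 mul1r.
  case: (unliftP 0 j) => [k|] -> /=.
    rewrite !ord1/= -[RHS]mulr1 -sumE; ring.
  have -> : z * ((t / (s + t))%:C * z^*) = (t / (s + t))%:C by rewrite mulrCA zz mulr1.
  exact: sumE.
- by apply/eqP => /rowP/(_ 0); rewrite !mxE/=; apply/eqP; rewrite oner_eq0.
- move=> j; under eq_bigr do rewrite modulus_pairmx// ?ltW//.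
  have := @Bmx_sum 2 s t j.
  have -> : 2%:R - 1 = 1 :> R by ring.
  by rewrite mul1r => ->//; rewrite gt_eqF.
- by move=> i j; rewrite !modulus_pairmx// ?ltW// eq_sym.
Qed.

Lemma energy_inf_eq alpha a b nu1 nu2 m :
  (exists n (A : 'M[R[i]]_n), [/\ (0 < n)%N, admissible nu1 nu2 A,
     largest_eigenvalue A 1 & energy alpha a b A = m]) ->
  (forall n (A : 'M[R[i]]_n), admissible nu1 nu2 A -> largest_eigenvalue A 1 ->
     m <= energy alpha a b A) ->
  energy_inf alpha a b nu1 nu2 = m.
Proof.
move=> [n [A [n0 Aad Al AE]]] H; rewrite /energy_inf; set E := (X in inf X).
have Em : E m by exists n => //; exists A.
have lb : lbound E m by move=> _ [k _] [B [Bad Bl] <-]; exact: H.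
apply/eqP; rewrite eq_le; apply/andP; split.
  by apply: ge_inf => //; exists m.
by apply: lb_le_inf => //; exists m.
Qed.

End witnesses.

(** * Supports of measures on the circle *)

Section support.
Context {R : realType}.
Implicit Types (nu : probability (borelC R) R) (z : R[i]).

(** A countable base of the plane. Radii of balls in [R[i]] are themselves elements of [R[i]], hence
    the embedding of the rational radius. *)
Let rat_ball (c : rat * rat * rat) : set R[i] :=
  ball ((ratr c.1.1 +i* ratr c.1.2) : R[i]) ((ratr c.2 : R)%:C).

Let rat_ball_basis z (U : set R[i]) : open U -> U z ->
  exists2 c, rat_ball c z & rat_ball c `<=` U.
Proof.
move=> oU Uz.
have /nbhs_ballP[e /= e0 eU] : nbhs z U by exact: open_nbhs_nbhs.
pose d := complex.Re e.
have eE : e = d%:C by rewrite -(RRe_real (gtr0_real e0)).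
have d0 : 0 < d by move: e0; rewrite eE ltcR.
(* A centre within r of z keeps the ball of radius r inside the ball of radius 2r < d around z;
   approximating each coordinate to r/2 is enough. *)
have [r] := @rat_in_itvoo R 0 (d / 2) (divr_gt0 d0 (ltr0Sn R 1)).
rewrite in_itv/= => /andP[r0 rd].
have near x : exists p : rat, `|x - ratr p| < (ratr r : R) / 2.
  have [|p] := @rat_in_itvoo R (x - ratr r / 2) (x + ratr r / 2).
    by move: r0; lra.
  by rewrite in_itv/= => /andP[h1 h2]; exists p; rewrite ltr_norml; lra.
have [p px] := near (complex.Re z); have [q qy] := near (complex.Im z).
have zc : modulus ((ratr p +i* ratr q) - z) < ratr r.
  have -> : (ratr p +i* ratr q) - z =
     (ratr p - complex.Re z)%:C + 'i%C * (ratr q - complex.Im z)%:C.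
    by case: z {Uz eU px qy} => x y /=; apply/eqP; rewrite eq_complex/=;
      apply/andP; split; apply/eqP; ring.
  rewrite -ltcR -normC_modulus; apply: le_lt_trans (ler_normD _ _) _.
  rewrite normrM !normC_modulus !modulus_real modulusE/= expr0n add0r expr1n sqrtr1.
  by rewrite mul1r -rmorphD/= ltcR distrC (distrC (ratr q)); lra.
exists (p, q, r); rewrite /rat_ball /ball/= -?ball_normE/=.
  by rewrite normC_modulus ltcR.
move=> w; rewrite /ball/= normC_modulus ltcR => wc.
apply: eU; rewrite /ball/= eE.
apply: le_lt_trans (ler_distD (ratr p +i* ratr q) _ _) _.
rewrite distrC !normC_modulus -rmorphD/= ltcR; lra.
Qed.

Let open_measurable (U : set (borelC R)) : open (U : set R[i]) -> measurable U.
Proof. by move=> oU; exact: sub_sigma_algebra. Qed.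

Let measurable_circle : measurable (@unit_circle R : set (borelC R)).
Proof.
rewrite -(setCK (@unit_circle R)); apply: measurableC; apply: open_measurable.
apply: closed_openC.
have -> : @unit_circle R = (Num.norm : R[i] -> R[i]) @^-1` [set x | x = 1].
  by apply/seteqP; split=> z /=; rewrite /unit_circle/= normC_modulus; [move=> ->|case].
apply: preimage_closed; first by move=> z _; exact: norm_continuous.
rewrite -[X in closed X]setCK; apply: open_closedC; rewrite openE => x /= x1.
apply/nbhs_ballP; exists `|x - 1| => /=.
  by rewrite normr_gt0 subr_eq0; apply/eqP.
by move=> y; rewrite /ball/= => xy y1; move: xy; rewrite y1 ltxx.
Qed.

(* R[i] has a countable base, so the complement of the support is null. *)
Lemma msupport_circle nu : nu (@unit_circle R) = 1%E ->
  exists2 z, msupport nu z & modulus z = 1.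
Proof.
move=> nu1; apply: contrapT => H.
(* The null rational balls, enumerated with empty sets as padding; they cover every point of the
   circle outside the support. *)
pose N (k : nat) : set (borelC R) :=
  if unpickle k is Some c then
    (if nu (rat_ball c) == 0%E then rat_ball c else set0) else set0.
have N0 k : nu.-negligible (N k).
  rewrite /N; case: (unpickle k) => [c|]; last exact: negligible_set0.
  case: ifPn => [/eqP h|_]; last exact: negligible_set0.
  by apply/negligibleP => //; apply: open_measurable; exact: ball_open.
have : nu.-negligible (@unit_circle R : set (borelC R)).
  apply: negligibleS (negligible_bigcup N0) => z z1.
  have : ~ msupport nu z by move=> hz; apply: H; exists z.
  move=> /existsNP[U /not_implyP[oU /not_implyP[Uz /negP]]].
  rewrite -leNgt => U0.
  have [c cz cU] := rat_ball_basis oU Uz.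
  exists (pickle c); first exact: I.
  rewrite /N pickleK ifT; first exact: cz.
  rewrite eq_le measure_ge0 andbT; apply: le_trans U0.
  by apply: le_measure => //; rewrite inE; apply: open_measurable => //; exact: ball_open.
move=> /(proj1 (negligibleP nu measurable_circle)) nu0.
by move: nu1; rewrite nu0 => /eqP; rewrite eq_sym onee_eq0.
Qed.

End support.

(** * Optimal sizes *)

Section optimal_values.
Context {R : realType}.
Implicit Types (alpha a b s t : R).

(** The second hypothesis says that f does not decrease when moving away from u on either side. The
    first puts the ceiling of u in the domain, so at least one rounded value exists even if the
    floor is too small. *)
Lemma rounded_minimum (f : R -> R) (lo : nat) (u : R) : lo%:R - 1 < u ->
  (forall s t, lo%:R <= s -> lo%:R <= t -> (s - t) * (u - t) <= 0 -> f t <= f s) ->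
  exists2 k : nat, (lo <= k)%N & [/\ rounded_values f lo%:R u (f k%:R),
    forall n : nat, (lo <= n)%N -> f k%:R <= f n%:R &
    forall x, rounded_values f lo%:R u x -> exists2 n : nat, (lo <= n)%N & x = f n%:R].
Proof.
move=> lou fmono.
have natE (x : int) : lo%:R <= x%:~R :> R ->
    exists2 n : nat, (lo <= n)%N & x%:~R = n%:R :> R.
  move=> h; exists `|x|%N.
    by rewrite -(ler_nat R) (le_trans h)// [leRHS]pmulrn ler_int abszE ler_norm.
  have x0 : 0 <= x by rewrite -(ler0z R) (le_trans _ h).
  by rewrite -[in LHS](gez0_abs x0).
have cu : u <= (Num.ceil u)%:~R := ceil_ge u.
have fu : (Num.floor u)%:~R <= u := floor_le u.
have cl : lo%:R <= (Num.ceil u)%:~R :> R.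
  have := @ceil_gt_int _ u (lo%:Z - 1); rewrite rmorphB/= lou => h.
  by rewrite pmulrn ler_int -(subrK 1 lo%:Z) lezD1 h.
have [c cl' cE] := natE _ cl.
have fc n : (lo <= n)%N -> u <= n%:R -> f c%:R <= f n%:R.
  move=> ln un; apply: fmono; rewrite ?ler_nat// -cE.
  apply: mulr_ge0_le0; last by rewrite subr_le0.
  by rewrite subr_ge0 pmulrn ler_int ceil_le_int.
have rc : rounded_values f lo%:R u (f c%:R).
  by exists c%:R => //; split; [right; rewrite -cE|rewrite /= ler_nat].
have rE x : rounded_values f lo%:R u x -> exists2 n : nat, (lo <= n)%N & x = f n%:R.
  by move=> [y [[] -> /= yl] <-]; have [n ln ->] := natE _ yl; exists n.
(* If the floor is below lo, every integer of the domain is at least u and the ceiling alone is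
   optimal. *)
have [fl|fl] := leP (lo%:R : R) (Num.floor u)%:~R; last first.
  exists c => //; split => // n ln; apply: fc => //.
  have [//|un] := leP u n%:R; move: fl; rewrite ltNge => /negP[].
  apply: (@le_trans _ _ n%:R); first by rewrite ler_nat.
  by rewrite pmulrn ler_int floor_ge_int ltW.
have [d dl dE] := natE _ fl.
have fd n : (lo <= n)%N -> n%:R <= u -> f d%:R <= f n%:R.
  move=> ln un; apply: fmono; rewrite ?ler_nat// -dE.
  apply: mulr_le0_ge0; last by rewrite subr_ge0.
  by rewrite subr_le0 pmulrn ler_int floor_ge_int.
have rd : rounded_values f lo%:R u (f d%:R).
  by exists d%:R => //; split; [left; rewrite -dE|rewrite /= ler_nat].
have [dc|cd] := leP (f d%:R) (f c%:R).
  exists d => //; split => // n ln; have [un|nu] := leP u n%:R.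
    by apply: le_trans dc _; exact: fc.
  by apply: fd => //; exact: ltW.
exists c => //; split => // n ln; have [un|nu] := leP u n%:R; first exact: fc.
by apply: le_trans (ltW cd) _; apply: fd => //; exact: ltW.
Qed.

Lemma powR_root_cancel p (x : R) : p != 0 -> 0 <= x -> (x `^ (1 / p)) `^ p = x.
Proof. by move=> p0 x0; rewrite -powRrM divfK// powRr1. Qed.

Lemma energy_uniform alpha a b n (A : 'M[R[i]]_n) s t L :
  0 < alpha -> 0 < L -> 0 <= s -> 0 <= t ->
  (forall i j, modulus (A i j) = (if i == j then s else t) / L) ->
  energy alpha a b A =
  n%:R * (b * s `^ alpha + a / 2 * (n%:R - 1) * t `^ alpha) / L `^ alpha.
Proof.
move=> al0 L0 s0 t0 AE.
rewrite (@energy_const _ alpha a b n A (s / L) (t / L)).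
- rewrite !powRM ?invr_ge0 ?(ltW L0)//.
  have -> : L^-1 `^ alpha = (L `^ alpha)^-1.
    by rewrite -(powR_inv1 (ltW L0)) -powRrM mulrC powRrM powR_inv1 ?powR_ge0.
  by ring.
- by move=> i; rewrite AE eqxx.
- by move=> i j ij; rewrite AE -val_eqE/= ltn_eqF.
Qed.

End optimal_values.

(** * The functions psi and phi for 1 < alpha < 2 *)

Section superlinear.
Context {R : realType}.
Variables (alpha a b : R).
Hypotheses (al1 : 1 < alpha) (al2 : alpha < 2) (a0 : 0 < a) (b0 : 0 < b).

Let S := (1 / b) `^ (1 / (alpha - 1)).
Let T := (2 / a) `^ (1 / (alpha - 1)).

Let al0 : 0 < alpha. Proof. exact: lt_trans al1. Qed.
Let p01 : 0 < alpha - 1 < 1.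
Proof. by rewrite subr_gt0 al1 ltrBlDr. Qed.
Let p0 : alpha - 1 != 0. Proof. by rewrite subr_eq0 gt_eqF. Qed.
Let S0 : 0 < S. Proof. by rewrite powR_gt0// divr_gt0. Qed.
Let T0 : 0 < T. Proof. by rewrite powR_gt0// divr_gt0. Qed.
Let Sp : S `^ (alpha - 1) = 1 / b.
Proof. by rewrite powR_root_cancel// divr_ge0// ltW. Qed.
Let Tp : T `^ (alpha - 1) = 2 / a.
Proof. by rewrite powR_root_cancel// divr_ge0// ltW. Qed.
Let powR_alpha (x : R) : 0 <= x -> x `^ alpha = x * x `^ (alpha - 1).
Proof. by move=> x0; rewrite mulr_powRB1. Qed.

Let L_gt0 (t : R) : 1 <= t -> 0 < S + (t - 1) * T.
Proof. by move=> t1; rewrite ltr_wpDr// mulr_ge0 ?(ltW T0)// subr_ge0. Qed.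

Lemma psi_gt0 (t : R) : 1 <= t -> 0 < psi alpha a b t.
Proof.
move=> t1; rewrite divr_gt0 ?powR_gt0//; first exact: lt_le_trans t1.
exact: L_gt0.
Qed.

Lemma psi1 : psi alpha a b 1 = b.
Proof. by rewrite /psi subrr mul0r addr0 -/S Sp !div1r invrK. Qed.

Lemma psi_mul_le (m t : R) : 1 <= t -> m <= psi alpha a b t ->
  m * (true%:R * S + (t - 1) * T) `^ (alpha - 1) <= t.
Proof. by move=> t1; rewrite mul1r ler_pdivlMr// powR_gt0// L_gt0. Qed.

(** Since b S^alpha = S and (a/2) T^alpha = T, the numerator collapses to n times S + (n-1)T. Only
    moduli enter, so [pairmx] is covered as well as [Bmx]. *)
Lemma energy_psi n (A : 'M[R[i]]_n) : (0 < n)%N ->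
  (forall i j, modulus (A i j) =
     (if i == j then S else T) / (S + (n%:R - 1) * T)) ->
  energy alpha a b A = psi alpha a b n%:R.
Proof.
move=> n0 AE; have n1 : 1 <= n%:R :> R by rewrite ler1n.
have L0 := L_gt0 n1.
rewrite (energy_uniform a b al0 L0 (ltW S0) (ltW T0) AE) /psi -/S -/T.
rewrite !powR_alpha ?(ltW S0) ?(ltW T0) ?(ltW L0)// Sp Tp.
have := powR_gt0 (alpha - 1) L0; move: (_ `^ _) => X X0.
by field; rewrite !gt_eqF.
Qed.

Let psi_le (s t : R) : 1 <= s -> 1 <= t ->
  (s - t) * ((alpha - 1) * T * t - (S + (t - 1) * T)) <= 0 ->
  psi alpha a b t <= psi alpha a b s.
Proof.
move=> s1 t1; apply: ratio_powR_le => //; rewrite ?L_gt0//.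
exact: lt_le_trans t1.
Qed.

(** The first-order factor of [ratio_powR_le] is (2 - alpha) T (t_0 - t), so its sign condition says
    that t lies between s and t_0. *)
Lemma psi_argmin_le (s t : R) : 1 <= s -> 1 <= t ->
  (s - t) * (psi_argmin alpha a b - t) <= 0 -> psi alpha a b t <= psi alpha a b s.
Proof.
move=> s1 t1 h; apply: psi_le => //.
have ST : (a / (2 * b)) `^ (1 / (alpha - 1)) = S / T.
  have T2 : T != 0 by rewrite gt_eqF.
  apply: (canRL (mulfK T2)).
  rewrite -powRM ?divr_ge0 ?mulr_ge0 ?(ltW a0) ?(ltW b0)//.
  by congr (_ `^ _); field; rewrite !gt_eqF.
have -> : (alpha - 1) * T * t - (S + (t - 1) * T) =
    (2 - alpha) * T * (psi_argmin alpha a b - t).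
  rewrite /psi_argmin ST; field; rewrite gt_eqF//=.
  by rewrite subr_eq0 gt_eqF.
rewrite mulrCA; apply: mulr_ge0_le0 => //.
by rewrite mulr_ge0 ?(ltW T0)// subr_ge0 ltW.
Qed.

Lemma psi_argmin_gt0 : a / 2 < b -> 0 < psi_argmin alpha a b.
Proof.
move=> ab; rewrite mulr_gt0//; first by rewrite divr_gt0// subr_gt0.
rewrite subr_gt0.
have one : 1 = 1 `^ (1 / (alpha - 1)) :> R by rewrite powR1.
rewrite [X in _ < X]one; apply: gt0_ltr_powR.
- by rewrite divr_gt0// subr_gt0.
- by rewrite nnegrE divr_ge0 ?mulr_ge0 ?(ltW a0) ?(ltW b0).
- by rewrite nnegrE.
- by rewrite ltr_pdivrMr ?mulr_gt0// mul1r; lra.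
Qed.

(** Here T <= S, so the first-order condition already holds at 1, where psi equals b. *)
Lemma psi1_le (t : R) : b <= a / 2 -> 1 <= t -> b <= psi alpha a b t.
Proof.
move=> ba t1; rewrite -[leLHS]psi1; apply: psi_le => //.
have TS : T <= S.
  apply: ge0_ler_powR; rewrite ?nnegrE ?divr_ge0 ?(ltW a0) ?(ltW b0)//.
    by rewrite ltW// subr_gt0.
  by rewrite ler_pdivrMr// mulrAC ler_pdivlMr//; lra.
apply: mulr_ge0_le0; first by rewrite subr_ge0.
rewrite subrr mul0r addr0 mulr1 subr_le0; apply: le_trans TS.
by rewrite ger_pMl//; case/andP: p01 => _ /ltW.
Qed.

Lemma phi_mul_le (m t : R) : 1 < t -> m <= phi alpha a t ->
  m * (false%:R * S + (t - 1) * T) `^ (alpha - 1) <= t.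
Proof.
move=> t1; have t1' : 0 < t - 1 by rewrite subr_gt0.
rewrite mul0r add0r powRM ?(ltW t1') ?(ltW T0)// Tp /phi => h.
have X0 := powR_gt0 (alpha - 1) t1'.
apply: le_trans (ler_wpM2r _ h) _; first by rewrite mulr_ge0 ?(ltW X0)// divr_ge0// ltW.
rewrite le_eqVlt; apply/orP; left; apply/eqP.
by field; rewrite !gt_eqF.
Qed.

Lemma phi_gt0 (t : R) : 1 < t -> 0 < phi alpha a t.
Proof.
move=> t1; rewrite /phi mulr_gt0 ?divr_gt0//; first exact: lt_trans t1.
by rewrite powR_gt0// subr_gt0.
Qed.

Lemma energy_phi n : (1 < n)%N -> energy alpha a b (Bmx n 0 1) = phi alpha a n%:R.
Proof.
move=> n1; have n1' : 0 < n%:R - 1 :> R by rewrite subr_gt0 ltr1n.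
have L0 : 0 < 0 + (n%:R - 1) * 1 :> R by rewrite add0r mulr1.
rewrite (energy_uniform a b al0 L0 (lexx 0) ler01) => [|i j]; last exact: modulus_Bmx.
rewrite add0r mulr1 powR0 ?gt_eqF// powR1 powR_alpha ?(ltW n1')// /phi.
have := powR_gt0 (alpha - 1) n1'; move: (_ `^ _) => X X0.
by field; rewrite !gt_eqF.
Qed.

(** Up to the factor a/2, phi is the ratio of [ratio_powR_le] with S = 0 and T = 1. *)
Lemma phi_argmin_le (s t : R) : 2 <= s -> 2 <= t ->
  (s - t) * (phi_argmin alpha - t) <= 0 -> phi alpha a t <= phi alpha a s.
Proof.
move=> s2 t2 h; rewrite /phi ler_pM2l ?divr_gt0//.
have := @ratio_powR_le R (alpha - 1) 0 1 s t p01.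
rewrite !add0r !mulr1; apply; try lra.
have -> : (alpha - 1) * t - (t - 1) = (2 - alpha) * (phi_argmin alpha - t).
  by rewrite /phi_argmin; field; rewrite subr_eq0 gt_eqF.
by rewrite mulrCA; apply: mulr_ge0_le0 => //; rewrite subr_ge0 ltW.
Qed.

Lemma phi_argmin_gt1 : 1 < phi_argmin alpha.
Proof. by rewrite /phi_argmin ltr_pdivlMr ?subr_gt0//; move: al1; lra. Qed.

End superlinear.

(** * Matching upper and lower bounds in the six regimes *)

Theorem proposition8p1 (R : realType) (d : measure_display)
    (T : measurableType d) (P : probability T R) (alpha a b : R)
    (Xd : nat -> {RV P >-> R}) (Xo : nat * nat -> {RV P >-> borelC R})
    (nu1 nu2 : probability (borelC R) R)
    (halpha : 0 < alpha < 2) (ha : 0 < a) (hb : 0 < b)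
    (hX : wigner_assumptions alpha a b Xd Xo nu1 nu2) :
  let c := energy_inf alpha a b nu1 nu2 in
  [/\          
      alpha <= 1 ->
        (msupport nu1 1 -> c = Num.min b a) /\ (~ msupport nu1 1 -> c = a),
               
      1 < alpha -> msupport nu1 1 -> b <= a / 2 -> c = b,
               
      1 < alpha -> (msupport nu1 `&` msupport nu2) 1 -> a / 2 < b ->
        is_min [set energy alpha a b
                      (Bmx n ((1 / b) `^ (1 / (alpha - 1)))
                             ((2 / a) `^ (1 / (alpha - 1))))
               | n in [set n | (1 <= n)%N]] c /\
        is_min (rounded_values (psi alpha a b) 1 (psi_argmin alpha a b)) c,
               
      1 < alpha -> msupport nu1 1 -> msupport nu2 = [set -1] -> a / 2 < b ->
        c = Num.min b (2 / ((1 / b) `^ (1 / (alpha - 1)) +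
                            (2 / a) `^ (1 / (alpha - 1))) `^ (alpha - 1))
    & [/\          
          1 < alpha -> msupport nu1 = [set -1] -> msupport nu2 1 ->
            is_min [set energy alpha a b (Bmx n 0 1)
                   | n in [set n | (2 <= n)%N]] c /\
            is_min (rounded_values (phi alpha a) 2 (phi_argmin alpha)) c
        &          
          1 < alpha -> msupport nu1 = [set -1] -> msupport nu2 = [set -1] ->
            c = a]].
Proof.
move=> c; rewrite {}/c; have /andP[al0 al2] := halpha.
have S0 : 0 < (1 / b) `^ (1 / (alpha - 1)) by rewrite powR_gt0// divr_gt0.
have T0 : 0 < (2 / a) `^ (1 / (alpha - 1)) by rewrite powR_gt0// divr_gt0.
have L0 n : (0 < n)%N -> 0 < (1 / b) `^ (1 / (alpha - 1)) +
    (n%:R - 1) * (2 / a) `^ (1 / (alpha - 1)).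
  by move=> n0; rewrite ltr_wpDr// mulr_ge0 ?(ltW T0)// subr_ge0 ler1n.
have [z z2 z1] := msupport_circle (nu2_circle hX).
have mN1 : modulus (-1 : R[i]) = 1.
  by rewrite modulusE/= oppr0 expr0n addr0 sqrrN expr1n sqrtr1.
(* The 1 x 1 matrix with entry 1. *)
have wit_b : msupport nu1 1 -> exists n (A : 'M[R[i]]_n), [/\ (0 < n)%N,
    admissible nu1 nu2 A, largest_eigenvalue A 1 & energy alpha a b A = b].
  move=> h1; have L1 : 0 < 1 + (1%:R - 1) * 1 :> R by rewrite subrr mul0r addr0.
  have [] := @Bmx_feasible R nu1 nu2 1 1 1 isT ler01 ler01 L1 (fun _ => h1).
    by [].
  exists 1%N, (Bmx 1 1 1); split => //.
  have := @energy_uniform R alpha a b 1 (Bmx 1 1 1) 1 1 (1 + (1%:R - 1) * 1)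
    al0 L1 ler01 ler01.
  move=> -> => [|i j]; last exact: modulus_Bmx.
  by rewrite subrr mul0r addr0 !powR1 mulr0 mul0r addr0 divr1 mul1r mulr1.
(* Zero diagonal and a single off-diagonal pair of modulus 1, in a direction z taken from the
   support of [nu2]. *)
have wit_a : exists n (A : 'M[R[i]]_n), [/\ (0 < n)%N,
    admissible nu1 nu2 A, largest_eigenvalue A 1 & energy alpha a b A = a].
  have [] := @pairmx_feasible R nu1 nu2 0 1 z (lexx 0) ltr01 z1 _ z2.
    by rewrite eqxx.
  exists 2%N, (pairmx 0 1 z); split => //.
  have L1 : 0 < 0 + 1 :> R by rewrite add0r.
  have := @energy_uniform R alpha a b 2 (pairmx 0 1 z) 0 1 (0 + 1) al0 L1 (lexx 0) ler01.
  move=> -> => [|i j]; last exact: (modulus_pairmx i j (lexx 0) ler01 L1 z1).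
  by rewrite add0r !powR1 powR0 ?gt_eqF//; field.
have wit_pair : 1 < alpha -> msupport nu1 1 -> msupport nu2 (-1) ->
    exists n (A : 'M[R[i]]_n), [/\ (0 < n)%N, admissible nu1 nu2 A,
      largest_eigenvalue A 1 & energy alpha a b A = psi alpha a b 2].
  move=> al1 h1 h2.
  have [] := pairmx_feasible (ltW S0) T0 mN1 (fun _ => h1) h2.
  exists 2%N, (pairmx ((1 / b) `^ (1 / (alpha - 1))) ((2 / a) `^ (1 / (alpha - 1))) (-1)).
  split => //; apply: energy_psi => // i j.
  have -> : (2%:R - 1) * (2 / a) `^ (1 / (alpha - 1)) = (2 / a) `^ (1 / (alpha - 1)).
    by ring.
  by apply: modulus_pairmx => //; rewrite ?ltW// addr_gt0.
split.
- move=> al1; have al01 : 0 < alpha <= 1 by rewrite al0.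
  split=> h1; apply: energy_inf_eq => //.
  + by have [_|_] := leP b a; [exact: wit_b|exact: wit_a].
  + move=> n A [Ah _] [Ae _]; apply: energy_ge_concave => //.
    * by rewrite lt_min hb.
    * by rewrite ge_min lexx orbT.
    * by move=> i; left; rewrite ge_min lexx.
  + move=> n A Aad [Ae _]; have [Ah _] := Aad; apply: energy_ge_concave => // i.
    by right; exact: admissible_diag_le0 Aad h1.
- move=> al1 h1 ba; apply: energy_inf_eq; first exact: wit_b.
  move=> n A [Ah _] [Ae _]; apply: (@energy_ge_general _ _ _ _ _ true) => //.
    by move=> i; left.
  by move=> k k0; apply: psi_mul_le; rewrite ?ler1n//; apply: psi1_le; rewrite ?ler1n.
- move=> al1 [h1 h2] ab.
  have [|s t s1 t1|k k0 [rk kmin rE]] :=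
      @rounded_minimum R (psi alpha a b) 1 (psi_argmin alpha a b).
  + by rewrite subrr; exact: psi_argmin_gt0.
  + exact: psi_argmin_le.
  have BE n : (0 < n)%N -> energy alpha a b (Bmx n ((1 / b) `^ (1 / (alpha - 1)))
      ((2 / a) `^ (1 / (alpha - 1)))) = psi alpha a b n%:R.
    move=> n0; apply: energy_psi => // i j.
    by apply: modulus_Bmx; rewrite ?ltW// L0.
  have -> : energy_inf alpha a b nu1 nu2 = psi alpha a b k%:R.
    apply: energy_inf_eq.
      have [] := @Bmx_feasible R nu1 nu2 k _ _ k0 (ltW S0) (ltW T0) (L0 _ k0)
        (fun _ => h1) (fun _ => h2).
      by eexists; eexists; split; last exact: BE.
    move=> n A [Ah _] [Ae _]; apply: (@energy_ge_general _ _ _ _ _ true) => //.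
    * by apply: psi_gt0; rewrite ?ler1n.
    * by move=> i; left.
    * by move=> l l0; apply: psi_mul_le; rewrite ?ler1n//; exact: kmin.
  split; split => //.
  + by exists k => //; exact: BE.
  + by move=> _ [n n0 <-]; rewrite BE//; exact: kmin.
  + by move=> x /rE [n n0 ->]; exact: kmin.
- move=> al1 h1 h2 ab.
  have -> : 2 / ((1 / b) `^ (1 / (alpha - 1)) +
      (2 / a) `^ (1 / (alpha - 1))) `^ (alpha - 1) = psi alpha a b 2.
    by rewrite /psi; congr (_ / (_ + _) `^ _); ring.
  apply: energy_inf_eq.
    have [_|_] := leP b (psi alpha a b 2); first exact: wit_b.
    by apply: wit_pair; rewrite ?h2.
  move=> n A Aad [Ae _]; have [Ah _] := Aad.
  apply: (@energy_ge_negative _ _ _ _ _ true) => //.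
  + by rewrite lt_min hb psi_gt0// ler1n.
  + by move=> i j; exact: admissible_offdiag_neg Aad h2.
  + by move=> i; left.
  (* The sizes 1 and 2 give the two terms of the minimum, psi(1) = b and psi(2). *)
  + move=> [|[|[|k]]]// _; apply: psi_mul_le => //; rewrite ?ler1n//.
      by rewrite psi1// ge_min lexx.
    by rewrite ge_min lexx orbT.
- split.
  + move=> al1 h1 h2.
    have N1 : ~ msupport nu1 1.
      rewrite h1 => /= /eqP; rewrite eq_complex/= => /andP[/eqP E _].
      by move: E; lra.
    have [|s t s1 t1|k k0 [rk kmin rE]] :=
        @rounded_minimum R (phi alpha a) 2 (phi_argmin alpha).
    * have -> : 2%:R - 1 = 1 :> R by ring.
      exact: phi_argmin_gt1.
    * exact: phi_argmin_le.
    have -> : energy_inf alpha a b nu1 nu2 = phi alpha a k%:R.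
      apply: energy_inf_eq.
        have L1 : 0 < 0 + (k%:R - 1) * 1 :> R.
          by rewrite add0r mulr1 subr_gt0 ltr1n.
        have [] := @Bmx_feasible R nu1 nu2 k 0 1 (ltnW k0) (lexx 0) ler01 L1 _ (fun _ => h2).
          by rewrite eqxx.
        by eexists; eexists; split; last exact: energy_phi; rewrite // ltnW.
      move=> n A Aad [Ae _]; have [Ah _] := Aad.
      apply: (@energy_ge_general _ _ _ _ _ false) => //.
      - by apply: phi_gt0; rewrite ?ltr1n.
      - by move=> i; right; exact: admissible_diag_le0 Aad N1.
      (* With S = 0 the size k = 1 gives 0^(alpha-1) = 0, so its condition is trivial and only k >=
         2, the domain of phi, remains. *)
      - move=> [|[|l]]// _.
          by rewrite subrr !mul0r addr0 powR0 ?mulr0// gt_eqF// subr_gt0.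
        by apply: phi_mul_le; rewrite ?ltr1n//; exact: kmin.
    split; split => //.
    * by exists k => //; exact: energy_phi.
    * by move=> _ [n n0 <-]; rewrite energy_phi//; exact: kmin.
    * by move=> x /rE [n n0 ->]; exact: kmin.
  + move=> al1 h1 h2.
    have N1 : ~ msupport nu1 1.
      rewrite h1 => /= /eqP; rewrite eq_complex/= => /andP[/eqP E _].
      by move: E; lra.
    apply: energy_inf_eq => // n A Aad [Ae _]; have [Ah _] := Aad.
    apply: (@energy_ge_negative _ _ _ _ _ false) => //.
    * by move=> i j; exact: admissible_offdiag_neg Aad h2.
    * by move=> i; right; exact: admissible_diag_le0 Aad N1.
    * move=> [|[|[|k]]]// _.
        by rewrite subrr !mul0r addr0 powR0 ?mulr0// gt_eqF// subr_gt0.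
      (* At size 2 the required bound is an equality, phi(2) = a. *)
      apply: phi_mul_le => //; rewrite ?ltr1n// /phi.
      have -> : 2 - 1 = 1 :> R by ring.
      by rewrite powR1 divr1 divfK.
Qed.
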